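(* Let $K,I,J,C,D$ be finite sets, $g:K\times I\times J\to[0,1]$ and $q:K\times I\times J\to\Delta(K\times C\times D)$, and assume that conditions (A1b), (A'2b) and (A'3) of the context hold. Then for all $\pi\in\Delta^*_f(K\times\mathbb N\times\mathbb N)$ (i.e. all $\pi\in\Delta_f(K\times\mathbb N\times\mathbb N)$ satisfying (A1a) and (A2a)), the repeated game $\Gamma(\pi)$ has a uniform value, i.e. $\underline v_\infty(\pi)=\overline v_\infty(\pi)$.
   Context: **Model.** For a metric space $X$, $\Delta(X)$ is the set of Borel probability distributions on $X$ and $\Delta_f(X)\subset\Delta(X)$ those with finite support. $K$ (states), $I,J$ (actions of players 1, 2), $C,D$ (signals of players 1, 2) are finite, $g$ is the payoff, $q$ the transition (both extended linearly to $\Delta(K)\times I\times J$, e.g. $q(p,i,j)=\sum_kp(k)q(k,i,j)$), and $\pi\in\Delta_f(K\times\mathbb N\times\mathbb N)$ the initial probability. At the start $(k_1,c_1,d_1)$ is drawn from $\pi$. At stage $m\ge1$ player 1 observes $c_m$, player 2 observes $d_m$; then they choose actions $i_m\in I$, $j_m\in J$ (perfect recall of own past signals and actions); $(k_{m+1},c_{m+1},d_{m+1})$ is drawn from $q(k_m,i_m,j_m)$; the stage payoff of player 1 is $g(k_m,i_m,j_m)$ (not observed). A behavior strategy of player 1 (set $\Sigma$) is a sequence $\sigma_m:\mathbb N\times(I\times C)^{m-1}\to\Delta(I)$ (a function of $h^I_m=(c_1,i_1,\dots,i_{m-1},c_m)$), and of player 2 (set $\mathcal T$) a sequence $\tau_m:\mathbb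 N\times(J\times D)^{m-1}\to\Delta(J)$ (a function of $h^{II}_m=(d_1,j_1,\dots,j_{m-1},d_m)$). $\mathbb P^\pi_{\sigma\tau}$ is the induced probability on plays and $\gamma_n(\pi,\sigma,\tau)=\mathbb E^\pi_{\sigma\tau}[\frac1n\sum_{m=1}^n g(k_m,i_m,j_m)]$. **Uniform value.** Player 1 can guarantee $v\in\mathbb R$ in $\Gamma_\infty(\pi)$ if for every $\epsilon>0$ there are $\sigma\in\Sigma$ and $N$ with $\gamma_n(\pi,\sigma,\tau)\ge v-\epsilon$ for all $n\ge N$, $\tau\in\mathcal T$; $\underline v_\infty(\pi)$ is the supremum of such $v$. Player 2 can guarantee $v$ if for every $\epsilon>0$ there are $\tau\in\mathcal T$ and $N$ with $\gamma_n(\pi,\sigma,\tau)\le v+\epsilon$ for all $n\ge N$, $\sigma\in\Sigma$; $\overline v_\infty(\pi)$ is the infimum of such $v$. The uniform value exists if the two are equal. **Conditions.** Put $x_1=\mathcal L_\pi(k_1\mid c_1)\in\Delta(K)$ (conditional law) and $y_1=\mathcal L_\pi(x_1\mid d_1)\in\Delta_f(\Delta(K))$. - (A1a) for $\pi$: $\pi(c)\pi(k,c,d)=\pi(k,c)\pi(c,d)$ for all $(k,c,d)$ (marginals denoted by omitting variables). - (A2a) for $\pi$: there is a map $f_1$ from initial signals of player 1 to $\Delta(\Delta(K))$ with $y_1=f_1(c_1)$ $\pi$-almost surely. - (A1b): there is a map $F:\Delta(K)\times I\times C\to\Delta(K)$ such that for all $(p,i,j,c,d,k)\in\Delta(K)\times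 I\times J\times C\times D\times K$, $q(p,i,j)[k,c,d]=F(p,i,c)[k]\sum_{k'\in K}q(p,i,j)[k',c,d]$. - (A'2b): there is a map $h:C\to D$ such that for all $(k,i,j)\in K\times I\times J$, $\sum_{c\in C}q(k,i,j)[c,h(c)]=1$, where $q(k,i,j)[c,d]=\sum_{k'}q(k,i,j)[k',c,d]$. - (A'3): for all $x\in\Delta(K)$ and $i\in I$, the image of the probability $q_{C\times D}(x,i,j)$ under the map $H_{x,i}$ does not depend on $j\in J$, where $q_{C\times D}(x,i,j)(c,d)=\sum_{k,\tilde k}x(k)q(k,i,j)(\tilde k,c,d)$ is the marginal on $C\times D$ and $H_{x,i}(c,d)=(F(x,i,c),d)\in\Delta(K)\times D$. *)

(* Defs.v *)
From HB Require Import structures.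
From mathcomp Require Import all_boot all_order all_algebra finmap.
From mathcomp Require Import all_classical all_reals all_analysis.

Set Implicit Arguments.
Unset Strict Implicit.
Unset Printing Implicit Defensive.

Import Order.TTheory GRing.Theory Num.Theory.
Local Open Scope classical_set_scope.
Local Open Scope ring_scope.

(* Delta(T) for a finite set T. *)
Record dist (R : realType) (T : finType) := Dist {
  dval :> {ffun T -> R};
  distP : [forall t, 0 <= dval t] && (\sum_t dval t == 1) }.
Arguments dist R T%_type_scope.

HB.instance Definition _ (R : realType) (T : finType) :=
  [isSub for @dval R T].
HB.instance Definition _ (R : realType) (T : finType) :=
  [Choice of dist R T by <:].

(* Delta_f(T) for an arbitrary set T. *)
Record fdist (R : realType) (T : choiceType) := FDist {
  fval :> {fsfun T -> R with 0};
  fdist_ge0 : forall t, 0 <= fval t;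
  fdist_sum1 : \sum_(t <- finsupp fval) fval t = 1 }.
Arguments fdist R T%_type_scope.

Definition prob (R : realType) (T : choiceType) (mu : fdist R T)
    (E : pred T) : R := \sum_(t <- finsupp mu | E t) mu t.

(* An initial draw is w = (k_1, c_1, d_1), associated as ((k_1, c_1), d_1). *)
Notation st w := w.1.1 (only parsing).
Notation sig1 w := w.1.2 (only parsing).
Notation sig2 w := w.2 (only parsing).

Section Initial.
Variables (R : realType) (K : finType) (mu : fdist R (K * nat * nat)).

Lemma state_law_subproof :
  let f := [ffun k => prob mu (fun w => st w == k)] in
  [forall k, 0 <= f k] && (\sum_k f k == 1).
Proof.
apply/andP; split.
  by apply/forallP => k; rewrite ffunE; apply: sumr_ge0 => w _; exact: fdist_ge0.
apply/eqP; rewrite -(fdist_sum1 mu).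
under eq_bigr do rewrite ffunE /prob.
rewrite (exchange_big_dep predT) //=.
apply: eq_bigr => w _; rewrite (bigD1 (st w)) //= big1 ?addr0 // => k.
by case/andP => /eqP ->; rewrite eqxx.
Qed.

Definition state_law : dist R K := Dist state_law_subproof.

(* x_1 = L(k_1 | c_1 = c); the default value [state_law] is only used when
   c has probability zero. *)
Definition belief1 (c : nat) : dist R K :=
  insubd state_law
    [ffun k => prob mu (fun w => (st w == k) && (sig1 w == c))
               / prob mu (fun w => sig1 w == c)].

Lemma belief1E (c : nat) (k : K) : 0 < prob mu (fun w => sig1 w == c) ->
  belief1 c k = prob mu (fun w => (st w == k) && (sig1 w == c))
                / prob mu (fun w => sig1 w == c).
Proof.
move=> c0; rewrite /belief1 /insubd insubT /= ?ffunE //.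
apply/andP; split.
  apply/forallP => k'; rewrite ffunE divr_ge0 ?(ltW c0) //.
  by apply: sumr_ge0 => w _; exact: fdist_ge0.
apply/eqP; under eq_bigr do rewrite ffunE.
rewrite -mulr_suml -[RHS](divff (lt0r_neq0 c0)); congr (_ / _).
rewrite /prob (exchange_big_dep (fun w => sig1 w == c)) /=; last first.
  by move=> k' w _ /andP[].
apply: eq_bigr => w wc; rewrite (bigD1 (st w)) ?eqxx //= big1 ?addr0 // => k'.
by case/andP => /andP[/eqP -> _]; rewrite eqxx.
Qed.

(* y_1 = L(x_1 | d_1 = d), as a set function on Delta(K); meaningful when
   d has positive probability. *)
Definition belief2 (d : nat) (A : set (dist R K)) : \bar R :=
  (prob mu (fun w => (sig2 w == d) && (belief1 (sig1 w) \in A))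
   / prob mu (fun w => sig2 w == d))%:E.

End Initial.

(* Delta(K) has no canonical point, since K may be empty, but measurable types
   are pointed: [simplex p] is Delta(K) pointed at p. *)
Definition simplex (R : realType) (K : finType) (p : dist R K) := dist R K.
HB.instance Definition _ (R : realType) (K : finType) (p : dist R K) :=
  Choice.on (simplex p).
HB.instance Definition _ (R : realType) (K : finType) (p : dist R K) :=
  isPointed.Build (simplex p) p.

(* Open sets of Delta(K) for the distance induced by the l^1 norm. *)
Definition simplex_open (R : realType) (K : finType) (p : dist R K) :
    set (set (simplex p)) :=
  [set U | forall x : dist R K, U x -> exists2 e : R, 0 < e &
     forall y : dist R K, \sum_k `|x k - y k| < e -> U y].

Definition borel_simplex (R : realType) (K : finType) (p : dist R K) :=
  g_sigma_algebraType (@simplex_open R K p).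

Definition condA1a (R : realType) (K : finType) (mu : fdist R (K * nat * nat)) :=
  forall (k : K) (c d : nat),
    prob mu (fun w => sig1 w == c) * mu (k, c, d) =
    prob mu (fun w => (st w == k) && (sig1 w == c)) *
    prob mu (fun w => (sig1 w == c) && (sig2 w == d)).

Definition condA2a (R : realType) (K : finType) (mu : fdist R (K * nat * nat)) :=
  exists f1 : nat -> probability (borel_simplex (state_law mu)) R,
    forall w, 0 < mu w ->
      forall A : set (borel_simplex (state_law mu)), measurable A ->
        belief2 mu (sig2 w) A = f1 (sig1 w) A.

Section Transition.
Variables (R : realType) (K I J C D : finType).
Variable q : K -> I -> J -> dist R (K * C * D).

Definition qext (p : dist R K) (i : I) (j : J) (z : K * C * D) : R :=
  \sum_k p k * q k i j z.

Definition condA1b (F : dist R K -> I -> C -> dist R K) :=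
  forall (p : dist R K) (i : I) (j : J) (c : C) (d : D) (k : K),
    qext p i j (k, c, d) = F p i c k * \sum_k' qext p i j (k', c, d).

Definition condA2b' :=
  exists h : C -> D, forall (k : K) (i : I) (j : J),
    \sum_c \sum_k' q k i j (k', c, h c) = 1.

Definition qCD (x : dist R K) (i : I) (j : J) (cd : C * D) : R :=
  \sum_k \sum_k' x k * q k i j (k', cd.1, cd.2).

(* Mass at z of the image of q_{C x D}(x, i, j) under
   H_{x,i} : (c, d) |-> (F(x, i, c), d). *)
Definition image_law (F : dist R K -> I -> C -> dist R K)
    (x : dist R K) (i : I) (j : J) (z : dist R K * D) : R :=
  \sum_(cd : C * D | (F x i cd.1, cd.2) == z) qCD x i j cd.

Definition condA3' (F : dist R K -> I -> C -> dist R K) :=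
  forall (x : dist R K) (i : I) (j j' : J),
    image_law F x i j =1 image_law F x i j'.

End Transition.

(* Behavior strategies for action set A and signal set S. The history
   (s_1, a_1, s_2, ..., a_{m-1}, s_m) is passed as s_1 in nat together with
   the sequence (a_1, s_2), ..., (a_{m-1}, s_m), whose length encodes m. *)
Definition strategy (R : realType) (A S : finType) :=
  nat -> seq (A * S) -> dist R A.

Section Game.
Variables (R : realType) (K I J C D : finType).
Variable g : K -> I -> J -> R.
Variable q : K -> I -> J -> dist R (K * C * D).
Variable mu : fdist R (K * nat * nat).

(* ((i_m, j_m), ((k_{m+1}, c_{m+1}), d_{m+1})). *)
Definition step : finType := (I * J * (K * C * D))%type.

Section Play.
(* Stages are counted from 0 : stage l below is stage l + 1 of the game. *)
Variables (w : K * nat * nat) (n : nat) (s : n.-tuple step) (l : 'I_n).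

Definition act1 : I := (tnth s l).1.1.
Definition act2 : J := (tnth s l).1.2.
Definition state : K := nth (st w) (st w :: [seq st a.2 | a <- s]) l.
Definition hist1 : seq (I * C) := take l [seq (a.1.1, sig1 a.2) | a <- s].
Definition hist2 : seq (J * D) := take l [seq (a.1.2, sig2 a.2) | a <- s].

End Play.

(* Probability that the play starts with w followed by the steps s. *)
Definition play_prob (sigma : strategy R I C) (tau : strategy R J D)
    (w : K * nat * nat) (n : nat) (s : n.-tuple step) : R :=
  mu w * \prod_(l < n)
    (sigma (sig1 w) (hist1 s l) (act1 s l) *
     tau (sig2 w) (hist2 s l) (act2 s l) *
     q (state w s l) (act1 s l) (act2 s l) (tnth s l).2).

Definition gamma (n : nat) (sigma : strategy R I C) (tau : strategy R J D) : R :=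
  \sum_(w <- finsupp mu) \sum_(s : n.-tuple step)
    play_prob sigma tau w s *
    (n%:R^-1 * \sum_(l < n) g (state w s l) (act1 s l) (act2 s l)).

Definition guarantee1 (v : R) :=
  forall e : R, 0 < e -> exists (sigma : strategy R I C) (N : nat),
    forall (n : nat) (tau : strategy R J D),
      (N <= n)%N -> v - e <= gamma n sigma tau.

Definition guarantee2 (v : R) :=
  forall e : R, 0 < e -> exists (tau : strategy R J D) (N : nat),
    forall (n : nat) (sigma : strategy R I C),
      (N <= n)%N -> gamma n sigma tau <= v + e.

Definition lower_value : R := sup [set v | guarantee1 v].
Definition upper_value : R := inf [set v | guarantee2 v].

Definition has_uniform_value := lower_value = upper_value.

End Game.

(* Main.v *)
(* By (A1b) and (A'3), player 1 controls the law of the pairs (own belief on the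
   state, signal of player 2), whatever player 2 does; by (A'2b), (A1a) and (A2a)
   he also knows everything player 2 knows about this belief. Against a best reply
   of player 2 the game is thus a deterministic dynamic program for player 1,
   whose states are the joint laws of player 2's information and of player 1's
   belief.

   Let v be the infimum over T of the supremum over m of what player 1 can secure
   on average over the stages m+1, ..., m+T. Player 2 guarantees v by playing in
   successive blocks of length T, since he does not influence the state at the
   beginning of a block.

   For player 1 one has to turn good averages over long windows into good averages
   over all horizons. Say that a state is (N,a)-good if some strategy keeps all
   the averages over the first t <= N stages above a. A window with a large
   average contains a starting point that is good. By duality between player 1's
   strategies and mixtures of horizons and of replies of player 2, being good is
   stable under small perturbations, uniformly in N; since the space of states is
   totally bounded, (N,a)-good implies (N',a-e)-good for all N' as soon as N is
   large enough. Concatenating blocks with summable losses gives a strategy that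
   is good over all horizons. *)
Require Import Defs.
From mathcomp Require Import all_boot all_order all_algebra finmap.
From mathcomp Require Import all_classical all_reals all_analysis.
From mathcomp Require Import ring lra zify.

Set Implicit Arguments.
Unset Strict Implicit.
Unset Printing Implicit Defensive.

Import Order.TTheory GRing.Theory Num.Theory.
Local Open Scope ring_scope.

(** * An approximate minimax theorem *)

(** The left side is the squared distance from [a - b] to the nonpositive reals, and
    [a - Num.max 0 a] is a nonpositive number at distance [|Num.max 0 a - b|]. This quadratic bound
    replaces a differentiation of the squared distance. *)
Lemma sqr_pos_part_sub (R : realType) (a b : R) :
  Num.max 0 (a - b) ^+ 2 <= (Num.max 0 a - b) ^+ 2.
Proof.
case: (leP 0 (a - b)); case: (leP 0 a) => *; nra.
Qed.

(* The minimizer of the squared distance to the orthant [u >= v + e] yields the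
   separating weights; an almost minimizer is enough, so that no compactness is
   needed. *)
Lemma approx_minimax (R : realType) (B : finType) (U : set (B -> R)) (M v e : R) :
  (forall u w s, U u -> U w -> 0 <= s <= 1 ->
     U (fun b => s * u b + (1 - s) * w b)) ->
  (forall u b, U u -> `|u b| <= M) ->
  (exists u, U u) ->
  (forall u, U u -> exists b, u b <= v) ->
  0 < e ->
  exists beta : B -> R, [/\ (forall b, 0 <= beta b), \sum_b beta b = 1 &
    forall u, U u -> \sum_b beta b * u b <= v + e].
Proof.
move=> cvx bnd [u0 Uu0] minv e0.
pose e2 := e / 2; have e20 : 0 < e2 by rewrite divr_gt0.
pose pp (u : B -> R) b := Num.max 0 (v + e2 - u b).
pose phi u := \sum_b pp u b ^+ 2.
have phi0 u : 0 <= phi u by apply: sumr_ge0 => b _; exact: sqr_ge0.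
pose A := [set phi u | u in U]%classic.
have hA : has_inf A.
  by split; [exists (phi u0), u0 | exists 0 => _ [u _ <-]].
pose m := inf A.
pose N := (1 + \sum_(b : B) (M + M) ^+ 2).
have N0 : 0 < N by rewrite ltr_pwDl // sumr_ge0 // => b _; exact: sqr_ge0.
(* Moving from an almost minimizer by a fraction [s] costs a second-order term of at most
   [s ^+ 2 * N]; this [s] brings it below [s * e2 ^+ 2], the slack allowed for the almost minimizer
   itself. *)
pose s := Num.min 1 (e2 ^+ 2 / N).
have s0 : 0 < s by rewrite lt_min ltr01 divr_gt0 // exprn_gt0.
have s1 : s <= 1 by rewrite ge_min lexx.
have sN : s * N <= e2 ^+ 2.
  by rewrite -ler_pdivlMr // ge_min lexx orbT.
have [_ [u Uu <-] hu] : exists2 y, A y & y < m + s * e2 ^+ 2.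
  by apply: inf_adherent => //; rewrite mulr_gt0 // exprn_gt0.
have ppge b : 0 <= pp u b by rewrite le_max lexx.
pose P := \sum_b pp u b.
(* Aiming at [v + e2] instead of [v] keeps the total weight [P] away from zero, so that normalizing
   turns the error [e2 ^+ 2] into at most [e2]. *)
have Pge : e2 <= P.
  have [b ub] := minv _ Uu.
  rewrite /P (bigD1 b) //= -[leLHS]addr0 lerD ?sumr_ge0 //.
  by rewrite le_max; apply/orP; right; lra.
have P0 : 0 < P by exact: lt_le_trans Pge.
have key w : U w -> \sum_b pp u b * (w b - u b) <= e2 ^+ 2.
  move=> Uw.
  have s01 : 0 <= s <= 1 by rewrite ltW.
  have : m <= phi (fun b => s * w b + (1 - s) * u b).
    apply: ge_inf => /=; first exact: hA.2.
    by exists (fun b => s * w b + (1 - s) * u b) => //; exact: cvx.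
  have : phi (fun b => s * w b + (1 - s) * u b) <=
     \sum_b (pp u b - s * (w b - u b)) ^+ 2.
    apply: ler_sum => b _; rewrite /pp.
    rewrite (_ : _ - (_ + _) = v + e2 - u b - s * (w b - u b)); last by ring.
    exact: sqr_pos_part_sub.
  have -> : \sum_b (pp u b - s * (w b - u b)) ^+ 2 =
    phi u - s * ((\sum_b pp u b * (w b - u b)) *+ 2) + s ^+ 2 * \sum_b (w b - u b) ^+ 2.
    rewrite /phi -sumrMnl !mulr_sumr -sumrB -big_split /=.
    by apply: eq_bigr => b _; ring.
  have : \sum_b (w b - u b) ^+ 2 <= N.
    rewrite /N -[leLHS]add0r lerD // ler_sum // => b _.
    have := bnd _ b Uu; have := bnd _ b Uw; rewrite !ler_norml => /andP[? ?] /andP[? ?].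
    by rewrite -subr_ge0 subr_sqr mulr_ge0 //; lra.
  set a := \sum_b pp u b * _; set c := \sum_b (w b - u b) ^+ 2.
  move=> hc h1 h2.
  have : s * (a *+ 2) <= s * e2 ^+ 2 + s ^+ 2 * c by lra.
  have : s ^+ 2 * c <= s * (s * N) by rewrite expr2 -mulrA !ler_wpM2l // ltW.
  have : s * (s * N) <= s * e2 ^+ 2 by rewrite ler_wpM2l // ltW.
  move=> h3 h4 h5; have : s * (a *+ 2) <= s * (e2 ^+ 2 *+ 2) by lra.
  by rewrite ler_pM2l //; lra.
exists (fun b => pp u b / P); split.
- by move=> b; rewrite divr_ge0 // ltW.
- by rewrite -mulr_suml divff // gt_eqF.
move=> w Uw; have := key _ Uw.
have -> : \sum_b pp u b / P * w b = (\sum_b pp u b * w b) / P.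
  by rewrite mulr_suml; apply: eq_bigr => b _; rewrite mulrAC.
rewrite ler_pdivrMr // => hk.
have h1 : \sum_b pp u b * u b <= (v + e2) * P.
  rewrite mulr_sumr; apply: ler_sum => b _; rewrite /pp.
  by case: (leP 0 (v + e2 - u b)) => ?; nra.
have h2 : \sum_b pp u b * (w b - u b) = \sum_b pp u b * w b - \sum_b pp u b * u b.
  by rewrite -sumrB; apply: eq_bigr => b _; rewrite mulrBr.
have h3 : e2 ^+ 2 <= e2 * P by rewrite expr2 ler_pM2l.
rewrite h2 in hk; have -> : v + e = v + e2 + e2 by rewrite /e2; lra.
by rewrite [leRHS]mulrDl; lra.
Qed.

(** * Long-run averages in deterministic dynamic programs *)

Definition wsum (R : realType) (a : nat -> R) (n t : nat) : R :=
  \sum_(l < t) a (n + l)%N.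

Section WindowSums.
Variables (R : realType) (a : nat -> R).

Lemma wsum0 n : wsum a n 0 = 0.
Proof. by rewrite /wsum big_ord0. Qed.

Lemma wsumD n t u : wsum a n (t + u) = wsum a n t + wsum a (n + t) u.
Proof.
rewrite /wsum big_split_ord /=; congr (_ + _).
by apply: eq_bigr => i _; rewrite addnA.
Qed.

Hypothesis a01 : forall l, 0 <= a l <= 1.

Lemma wsum_ge0 n t : 0 <= wsum a n t.
Proof. by apply: sumr_ge0 => i _; case/andP: (a01 (n + i)). Qed.

Lemma wsum_le n t : wsum a n t <= t%:R.
Proof.
rewrite -[t in t%:R]card_ord -sum1_card natr_sum.
by apply: ler_sum => i _; case/andP: (a01 (n + i)).
Qed.

(* If every start in the window had a short bad stretch, these stretches would
   cover the window, up to an overshoot of at most [N]. *)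
Lemma good_start n T N (v d : R) : v <= 1 -> 0 <= d ->
  (0 < T)%N -> N%:R <= T%:R * d -> T%:R * v <= wsum a n T ->
  exists2 m, (n <= m < n + T)%N &
    forall t, (t <= N)%N -> t%:R * (v - d) <= wsum a m t.
Proof.
move=> v1 d0 T0 NT hT; apply: contrapT => nex.
have bad m : (n <= m < n + T)%N ->
    exists2 t, (t <= N)%N & wsum a m t < t%:R * (v - d).
  move=> hm; apply: contrapT => nb; apply: nex; exists m => // t tN.
  by rewrite leNgt; apply/negP => tb; apply: nb; exists t.
(* Bad stretches are chained from [n] on. The inequality is strict as soon as one stretch has been
   used, hence the exception for [e = 0]. *)
have cover u : (u <= T)%N -> exists2 e, (u <= e <= u + N)%N &
    wsum a n e < e%:R * (v - d) ?<= if (e == 0)%N.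
  elim: u => [_|u IHu uT]; first by exists 0%N => //=; rewrite wsum0 mul0r.
  have [e /andP[ue euN] he] := IHu (ltnW uT).
  case: (ltnP u e) => [lt|le]; first by exists e => //; lia.
  have {le ue euN} eu : e = u by apply/eqP; rewrite eqn_leq le.
  subst e.
  have [t tN ht] := bad (n + u)%N ltac:(lia).
  have t0 : (0 < t)%N by case: t ht tN => //; rewrite wsum0 mul0r ltxx.
  exists (u + t)%N; first by lia.
  rewrite addn_eq0 (gtn_eqF t0) andbF /= wsumD natrD mulrDl ler_ltD //.
  exact: lteifW he.
have [e /andP[Te eTN]] := cover _ (leqnn T).
rewrite (gtn_eqF (leq_trans T0 Te)) /= => he.
have e_T : (T + (e - T))%N = e by lia.
move: he; rewrite -[X in wsum a n X]e_T wsumD => he.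
have h1 := wsum_ge0 (n + T) (e - T).
have h2 : (e - T)%N%:R <= N%:R :> R by rewrite ler_nat; lia.
have h3 : e%:R = T%:R + (e - T)%N%:R :> R by rewrite -natrD e_T.
rewrite h3 in he.
have r0 : 0 <= (e - T)%N%:R :> R by [].
have : T%:R * v < (T%:R + (e - T)%N%:R) * (v - d) by lra.
move: r0 h2; set r := (e - T)%N%:R; set t := T%:R => r0 h2 h4.
have : r * v <= r by rewrite ler_piMr.
have : 0 <= r * d by rewrite mulr_ge0.
by lra.
Qed.

End WindowSums.

Lemma ex_nat_ge (R : realType) (x : R) : exists n : nat, x <= n%:R.
Proof.
exists (Num.bound `|x|); apply: le_trans (ler_norm x) _.
by apply: ltW; exact: archi_boundP.
Qed.

Section DynamicProgram.
Variables (R : realType) (S : Type) (ag : nat -> S -> S -> Prop).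
Variable gam : S -> nat -> R.
Hypothesis ag_refl : forall n s, ag n s s.
Hypothesis ag_le : forall m n s1 s2, (m <= n)%N -> ag n s1 s2 -> ag m s1 s2.
Hypothesis ag_gam : forall l s1 s2, ag l.+1 s1 s2 -> gam s1 l = gam s2 l.
Hypothesis ag_lim : forall (u : nat -> S) (n : nat -> nat),
  (forall k, (n k < n k.+1)%N) -> (forall k, ag (n k) (u k) (u k.+1)) ->
  exists s, forall k, ag (n k) (u k) s.
Hypothesis gam01 : forall s l, 0 <= gam s l <= 1.

(** States of the program are not formed as objects: the state reached at stage [n] is encoded by
    the plan [s], and its continuations are the plans [s'] that agree with [s] before stage [n]. *)
Definition good (n : nat) (s : S) (N : nat) (v : R) :=
  exists2 s', ag n s s' & forall t, (t <= N)%N -> t%:R * v <= wsum (gam s') n t.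

Lemma good_le n s N N' (v v' : R) : (N' <= N)%N -> v' <= v ->
  good n s N v -> good n s N' v'.
Proof.
move=> NN vv [s' ss' h]; exists s' => // t tN.
by apply: le_trans (h _ (leq_trans tN NN)); rewrite ler_wpM2l.
Qed.

Lemma ag_wsum n t s1 s2 : ag (n + t) s1 s2 -> wsum (gam s1) n t = wsum (gam s2) n t.
Proof.
move=> h; apply: eq_bigr => i _; apply: ag_gam; apply: ag_le h.
by have := ltn_ord i; lia.
Qed.

Hypothesis uniform_good : forall e, 0 < e -> exists N, forall n s v N',
  good n s N v -> good n s N' (v - e).

(** Goodness is first extended to the horizon [1 + T]. The window of length [T] starting at [n + 1]
    then has a large average, so [good_start] finds a good stage in it; skipping one stage forces
    [n < n']. *)
Lemma good_block n s N (v e : R) N1 : 0 < e ->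
  (forall n s v N', good n s N v -> good n s N' (v - e)) -> good n s N v ->
  exists n' s', [/\ (n < n')%N, ag n s s', good n' s' N1 (v - 3 * e) &
    forall t, (t <= n' - n)%N -> t%:R * (v - e) <= wsum (gam s') n t].
Proof.
move=> e0 /[apply] hN.
(* [T * e] has to dominate both the overshoot [N1] of [good_start] and the loss of the skipped
   stage. *)
have [T0 hT0] := ex_nat_ge ((N1%:R + 1 + `|v| + e) / e).
pose T := T0.+1; have hT : N1%:R + 1 + `|v| + e <= T%:R * e.
  by rewrite -ler_pdivrMr //; apply: le_trans hT0 _; rewrite ler_nat.
have [s' ss' h] := hN (1 + T)%N.
have v1 : v - e <= 1.
  have := h 1%N isT; rewrite mul1r => /le_trans; apply.
  exact: wsum_le.
have hv : - `|v| <= v by rewrite lerNnormlW.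
have N0 : 0 <= N1%:R :> R by [].
have hT1 : T%:R * (v - e - e) <= wsum (gam s') (n + 1) T.
  have := h _ (leqnn _); rewrite wsumD natrD.
  have := wsum_le (gam01 s') n 1.
  by lra.
have [||//||n' hn' hg] := good_start (gam01 s') (N := N1) (d := e) _ _ _ _ hT1.
- by lra.
- exact: ltW.
- have := normr_ge0 v; lra.
exists n', s'; split=> //.
- by case/andP: hn'; rewrite addn1.
- exists s' => // t tN; apply: le_trans (hg _ tN).
  by rewrite ler_wpM2l //; lra.
- by move=> t tn; apply: h; lia.
Qed.

(** Blocks given by [good_block] are chained, each one ending at a stage good enough to start the
    next; [ag_lim] glues the successive plans together. *)
Lemma uniform_from_good n s (v e : R) : 0 < e -> (forall N, good n s N v) ->
  exists2 s', ag n s s' & forall t, t%:R * (v - e) <= wsum (gam s') n t.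
Proof.
move=> e0 hg.
(* The [k]-th block lowers the level by [3 * ep k], and these losses add up to [e]. *)
pose ep k := e / (6 * 2 ^+ k).
have ep0 k : 0 < ep k by rewrite divr_gt0 // mulr_gt0 // exprn_gt0.
have [Nf hNf] := choice (fun k => uniform_good (ep0 k)).
pose vk k := v - e + e / 2 ^+ k.
have vkS k : vk k.+1 = vk k - 3 * ep k.
  rewrite /vk /ep exprS; field.
  by rewrite expf_neq0 // pnatr_eq0.
pose inv k (x : nat * S) := good x.1 x.2 (Nf k) (vk k).
pose next k (x y : nat * S) := [/\ (x.1 < y.1)%N, ag x.1 x.2 y.2, inv k.+1 y &
  forall t, (t <= y.1 - x.1)%N -> t%:R * (v - e) <= wsum (gam y.2) x.1 t].
have step k x : {y | inv k x -> next k x y}.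
  apply: cid; have [hx|] := pselect (inv k x); last by exists x.
  have [n' [s' [h1 h2 h3 h4]]] := good_block (Nf k.+1) (ep0 k) (@hNf k) hx.
  exists (n', s') => _; split=> //=; first by rewrite /inv /= vkS.
  move=> t /h4; apply: le_trans; rewrite ler_wpM2l // /vk /ep.
  have -> : e / (6 * 2 ^+ k) = e / 2 ^+ k / 6.
    by field; rewrite expf_neq0 // pnatr_eq0.
  have : 0 < e / 2 ^+ k by rewrite divr_gt0 // exprn_gt0.
  by lra.
pose x := fix x k := if k is k'.+1 then sval (step k' (x k')) else (n, s).
have hx k : inv k (x k).
  elim: k => [|k IH] /=; first by rewrite /inv /= /vk expr0 divr1 subrK; exact: hg.
  by have [] := svalP (step k (x k)) IH.
have hn k : next k (x k) (x k.+1) by exact: (svalP (step k (x k)) (hx k)).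
have [s' hs'] : exists s', forall k, ag (x k).1 (x k).2 s'.
  by apply: ag_lim => k; have [] := hn k.
exists s' => [|t]; first exact: (hs' 0%N).
have blk k u : (u <= (x k.+1).1 - (x k).1)%N ->
    u%:R * (v - e) <= wsum (gam s') (x k).1 u.
  move=> hu; have [lt _ _ /(_ u hu)] := hn k.
  rewrite (@ag_wsum _ _ _ s') //; apply: ag_le (hs' k.+1); lia.
have ge_n k : (n + k <= (x k).1)%N.
  elim: k => [|k IH]; first by rewrite addn0.
  by have [] := hn k; lia.
have full k : ((x k).1 - n)%N%:R * (v - e) <= wsum (gam s') n ((x k).1 - n).
  elim: k => [|k IH]; first by rewrite /= subnn wsum0 mul0r.
  have [lt _ _ _] := hn k; have := ge_n k => gk.
  have -> : ((x k.+1).1 - n = ((x k).1 - n) + ((x k.+1).1 - (x k).1))%N by lia.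
  rewrite wsumD natrD mulrDl lerD // subnKC; last by lia.
  exact: blk.
have [k hk1 hk2] : exists2 k, ((x k).1 - n <= t)%N & (t <= (x k.+1).1 - n)%N.
  have ex : exists k, (t <= (x k.+1).1 - n)%N.
    by exists t; have := ge_n t.+1; lia.
  have [[|k] hk mink] := ex_minnP ex; first by exists 0%N => //=; rewrite subnn.
  exists k.+1 => //; case: leqP => // /ltnW /mink; lia.
have := ge_n k => gk.
have -> : (t = ((x k).1 - n) + (t - ((x k).1 - n)))%N by lia.
rewrite wsumD natrD mulrDl lerD // subnKC; last by lia.
by apply: blk; lia.
Qed.

Lemma long_run_of_windows (v e : R) : 0 < e ->
  (forall T, exists m s, T%:R * v <= wsum (gam s) m T) ->
  exists s N, forall n, (N <= n)%N -> n%:R * (v - e) <= wsum (gam s) 0 n.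
Proof.
move=> e0 hv.
have v1 : v <= 1.
  have [m [s]] := hv 1%N; rewrite mul1r => /le_trans; apply.
  exact: wsum_le.
(* Four losses of [e / 4]: finding a good start, passing to all horizons, concatenating blocks, and
   neglecting the stages before [m']. *)
have e4 : 0 < e / 4 by rewrite divr_gt0.
have [N1 hN1] := uniform_good e4.
have [T0 hT0] := ex_nat_ge (N1%:R / (e / 4)).
have hT : N1%:R <= T0.+1%:R * (e / 4).
  by rewrite -ler_pdivrMr //; apply: le_trans hT0 _; rewrite ler_nat.
have [m [s hs]] := hv T0.+1.
have [m' _ hg] := good_start (gam01 s) v1 (ltW e4) (ltn0Sn _) hT hs.
have [s' _ hs'] : exists2 s', ag m' s s' &
    forall t, t%:R * (v - e / 4 - e / 4 - e / 4) <= wsum (gam s') m' t.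
  by apply: uniform_from_good => // N; apply: hN1; exists s.
have [N2 hN2] := ex_nat_ge (m'%:R / (e / 4)).
exists s', (m' + N2)%N => n hn.
have hm : m'%:R <= n%:R * (e / 4).
  rewrite -ler_pdivrMr //; apply: le_trans hN2 _; rewrite ler_nat; lia.
have -> : (n = m' + (n - m'))%N by lia.
have := hs' (n - m')%N; rewrite wsumD add0n.
have := wsum_ge0 (gam01 s') 0 m'.
have -> : (m' + (n - m'))%N%:R = n%:R :> R by congr (_%:R); lia.
rewrite natrB; last by lia.
have : m'%:R * v <= m'%:R by rewrite ler_piMr.
have : 0 <= m'%:R * e by rewrite mulr_ge0 // ltW.
by lra.
Qed.

End DynamicProgram.

(** A total boundedness argument. There are finitely many pairs of a code and a level [k * d]; for
    each pair with a failure, a failing horizon is fixed. If [N] exceeds all of them, goodness up to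
    [N] can be carried over to a state of the same code that fails, a contradiction. *)
Lemma uniform_good_of_codes (R : realType) (S : Type) (ag : nat -> S -> S -> Prop)
    (gam : S -> nat -> R) :
  (forall n s, ag n s s) -> (forall s l, 0 <= gam s l <= 1) ->
  (forall d : R, 0 < d -> exists (Cd : finType) (code : nat -> S -> Cd),
     forall n s n' s' N v, code n s = code n' s' ->
       good ag gam n s N v -> good ag gam n' s' N (v - d)) ->
  forall e : R, 0 < e -> exists N, forall n s v N',
    good ag gam n s N v -> good ag gam n s N' (v - e).
Proof.
move=> ag_refl gam01 codes e e0.
pose d := e / 3; have d0 : 0 < d by rewrite divr_gt0.
have [Cd [code hcode]] := codes d d0.
have [M hM] := ex_nat_ge d^-1.
pose bad (a : Cd) (k : nat) N :=
  exists n s, code n s = a /\ ~ good ag gam n s N (k%:R * d).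
have [Nf hNf] : exists Nf : Cd * 'I_M.+1 -> nat,
    forall a (k : 'I_M.+1) N, bad a k N -> bad a k (Nf (a, k)).
  have ex (x : Cd * 'I_M.+1) : exists N0, forall N, bad x.1 x.2 N -> bad x.1 x.2 N0.
    have [[N hN]|nN] := pselect (exists N, bad x.1 x.2 N); first by exists N.
    by exists 0%N => N hN; case: nN; exists N.
  by have [f hf] := choice ex; exists f => a k N; exact: (hf (a, k)).
exists (\max_x Nf x).+1 => n s v N' hg.
have v1 : v <= 1.
  have [s' _ /(_ 1%N isT)] := hg; rewrite mul1r => /le_trans; apply.
  exact: wsum_le.
have [ve|ve] := leP (v - e) 0.
  exists s => // t _; apply: le_trans (wsum_ge0 (gam01 s) n t).
  by rewrite mulr_ge0_le0.
(* The level [k * d] lies between [v - 2 * d] and [v - d]: low enough to survive the transfer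
   between equal codes, high enough to stay above [v - e]. *)
pose k := Num.truncn ((v - d) / d).
have : 0 <= (v - d) / d by rewrite divr_ge0 ?(ltW d0) // /d; rewrite /d in d0; lra.
move=> /truncn_itv /andP[]; rewrite -/k ler_pdivlMr // ltr_pdivrMr // -natr1 mulrDl mul1r => k1 k2.
have kM : (k < M.+1)%N.
  rewrite ltnS -(ler_nat R); apply: le_trans hM.
  by rewrite -[leRHS]mul1r ler_pdivlMr //; lra.
apply: contrapT => ng.
have : bad (code n s) (Ordinal kM) N'.
  exists n, s; split=> // hg'; apply: ng.
  by apply: good_le hg' => //=; rewrite /d in k1 k2 *; lra.
move=> /hNf [n1 [s1 [hc]]]; apply.
apply: (good_le (leqnn _) k1); apply: (hcode n s) => //.
apply: good_le hg => //; apply: leqW.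
exact: (leq_bigmax (code n s, Ordinal kM)).
Qed.

(** * Finite distributions and weighted lists *)

Section Dist.
Variables (R : realType) (T : finType).
Implicit Types p : dist R T.

Lemma dist_ge0 p t : 0 <= p t.
Proof. by case: p => f /= /andP[/forallP]. Qed.

Lemma dist_sum1 p : \sum_t p t = 1.
Proof. by case: p => f /= /andP[_ /eqP]. Qed.

(** The value [p] is a default for an [f] that is not a distribution, such as a conditional law
    given an event of mass zero. *)
Definition mkdist p (f : T -> R) : dist R T := insubd p [ffun t => f t].

Lemma mkdistE p f t : (forall t, 0 <= f t) -> \sum_t f t = 1 ->
  mkdist p f t = f t.
Proof.
move=> f0 f1; rewrite /mkdist /insubd insubT /= ?ffunE //.
apply/andP; split; first by apply/forallP => u; rewrite ffunE.
by rewrite -f1; apply/eqP/eq_bigr => u _; rewrite ffunE.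
Qed.

Definition dirac_dist (t0 : T) : dist R T.
Proof.
refine (@Dist R T [ffun t => (t == t0)%:R] _).
apply/andP; split; first by apply/forallP => t; rewrite ffunE.
rewrite (bigD1 t0) //= ffunE eqxx big1 ?addr0 // => t /negPf tt.
by rewrite ffunE tt.
Defined.

Lemma sum_dirac_dist t0 (f : T -> R) : \sum_t dirac_dist t0 t * f t = f t0.
Proof.
rewrite (bigD1 t0) //= ffunE eqxx mul1r big1 ?addr0 // => t /negPf tt.
by rewrite ffunE tt mul0r.
Qed.

Lemma avg_le p (f : T -> R) a : (forall t, f t <= a) -> \sum_t p t * f t <= a.
Proof.
move=> fa; rewrite -[leRHS]mul1r -(dist_sum1 p) mulr_suml.
by apply: ler_sum => t _; rewrite ler_wpM2l // dist_ge0.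
Qed.

Lemma avg_ge p (f : T -> R) a : (forall t, a <= f t) -> a <= \sum_t p t * f t.
Proof.
move=> fa; rewrite -[leLHS]mul1r -(dist_sum1 p) mulr_suml.
by apply: ler_sum => t _; rewrite ler_wpM2l // dist_ge0.
Qed.

Lemma dist_eq p p' : (forall t, p t = p' t) -> p = p'.
Proof. by move=> h; apply: val_inj; apply/ffunP => t; exact: h. Qed.

End Dist.

Section Extrema.
Variables (R : realType) (T : finType) (t0 : T).
Implicit Types f : T -> R.

Definition minf f := f [arg min_(t < t0) f t]%O.
Definition maxf f := f [arg max_(t > t0) f t]%O.

Lemma minf_le f t : minf f <= f t.
Proof. by rewrite /minf; case: Order.TotalTheory.arg_minP => // i _; exact. Qed.

Lemma minf_ex f : exists t, minf f = f t.
Proof. by eexists. Qed.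

Lemma maxf_ge f t : f t <= maxf f.
Proof. by rewrite /maxf; case: Order.TotalTheory.arg_maxP => // i _; exact. Qed.

Lemma maxf_ex f : exists t, maxf f = f t.
Proof. by eexists. Qed.

Lemma eq_maxf f f' : f =1 f' -> maxf f = maxf f'.
Proof. by move=> ff; congr maxf; apply: funext. Qed.

Lemma eq_minf f f' : f =1 f' -> minf f = minf f'.
Proof. by move=> ff; congr minf; apply: funext. Qed.

Lemma minf_ge f a : (forall t, a <= f t) -> a <= minf f.
Proof. by move=> h; have [t ->] := minf_ex f. Qed.

Lemma maxf_le f a : (forall t, f t <= a) -> maxf f <= a.
Proof. by move=> h; have [t ->] := maxf_ex f. Qed.

Lemma maxfZ f a : 0 <= a -> maxf (fun t => a * f t) = a * maxf f.
Proof.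
move=> a0; apply/eqP; rewrite eq_le; apply/andP; split.
  by apply: maxf_le => t; rewrite ler_wpM2l // maxf_ge.
have [t ->] := maxf_ex f; exact: (maxf_ge (fun t => a * f t)).
Qed.

End Extrema.

(* Finitely supported measures are represented by lists of weighted atoms. *)
Section WeightedLists.
Variables (R : realType) (X : choiceType).
Implicit Types (z : seq (R * X)) (f : X -> R).

Definition ig z f : R := \sum_(a <- z) a.1 * f a.2.
Definition nng z := all (fun a : R * X => 0 <= a.1) z.

Lemma eq_ig z f f' : f =1 f' -> ig z f = ig z f'.
Proof. by move=> ff; apply: eq_bigr => a _; rewrite ff. Qed.

Lemma igD z f f' : ig z (fun x => f x + f' x) = ig z f + ig z f'.
Proof. by rewrite -big_split; apply: eq_bigr => a _; rewrite mulrDr. Qed.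

Lemma igZ z c f : ig z (fun x => c * f x) = c * ig z f.
Proof. by rewrite /ig mulr_sumr; apply: eq_bigr => a _; rewrite mulrCA. Qed.

Lemma ig_sum z (A : Type) (r : seq A) (P : pred A) (f : A -> X -> R) :
  ig z (fun x => \sum_(t <- r | P t) f t x) = \sum_(t <- r | P t) ig z (f t).
Proof.
rewrite /ig exchange_big /=.
by apply: eq_bigr => a _; rewrite mulr_sumr.
Qed.

Lemma ler_ig z f f' : nng z -> (forall x, f x <= f' x) -> ig z f <= ig z f'.
Proof.
move=> /allP z0 ff; rewrite /ig [leLHS]big_seq [leRHS]big_seq.
apply: ler_sum => a az.
by rewrite ler_wpM2l // z0.
Qed.

Lemma ig_cst z c : ig z (fun=> c) = ig z (fun=> 1) * c.
Proof. by rewrite mulrC -igZ; apply: eq_ig => x; rewrite mulr1. Qed.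

Lemma ig0 z : ig z (fun=> 0) = 0.
Proof. by rewrite ig_cst mulr0. Qed.

Lemma ig_ge0 z f : nng z -> (forall x, 0 <= f x) -> 0 <= ig z f.
Proof. by move=> z0 f0; rewrite -(ig0 z); exact: ler_ig. Qed.

(** A list may repeat an atom; collecting equal atoms makes measures comparable point by point. *)
Lemma ig_atoms z f (s : seq X) : uniq s -> {subset map snd z <= s} ->
  ig z f = \sum_(x <- s) ig z (fun y => (y == x)%:R) * f x.
Proof.
move=> us zs; under eq_bigr do rewrite mulrC -igZ.
rewrite -(ig_sum z s predT (fun x y => f x * (y == x)%:R)).
rewrite /ig [LHS]big_seq [RHS]big_seq; apply: eq_bigr => a az; congr (_ * _).
rewrite (bigD1_seq a.2) ?us ?zs ?map_f //= eqxx mulr1 big1 ?addr0 // => x /negPf h.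
by rewrite eq_sym h mulr0.
Qed.

End WeightedLists.

Lemma sum_image (R : realType) (A : finType) (Z : choiceType) (w : A -> R)
    (H : A -> Z) (phi : Z -> R) :
  \sum_a w a * phi (H a) =
  \sum_(z <- undup [seq H a | a <- enum A]) (\sum_(a | H a == z) w a) * phi z.
Proof.
under [RHS]eq_bigr do rewrite mulr_suml.
rewrite (exchange_big_dep predT) //=; apply: eq_bigr => a _.
rewrite (big_rem (H a)) /=; last by rewrite mem_undup map_f // mem_enum.
rewrite eqxx big_seq_cond big1 ?addr0 // => z.
by rewrite mem_rem_uniq ?undup_uniq // inE => /andP[/andP[/negPf h _]]; rewrite eq_sym h.
Qed.

(** * The controlled process of beliefs and public signals *)

Section Kernel.
Variables (R : realType) (K I J C D : finType).
Variable g : K -> I -> J -> R.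
Hypothesis g01 : forall k i j, 0 <= g k i j <= 1.
Variable q : K -> I -> J -> dist R (K * C * D).
Variable F : dist R K -> I -> C -> dist R K.
Hypothesis qF : condA1b q F.
Variable h : C -> D.
Hypothesis qh : forall k i j, \sum_c \sum_k' q k i j (k', c, h c) = 1.
Hypothesis qj : condA3' q F.

(** Under [qh] this is the law of player 1's next signal: the signal of player 2 is then almost
    surely [h c], so no mass is lost by keeping only that value. *)
Definition kap (j : J) (x : dist R K) (i : I) (c : C) : R :=
  \sum_k' qext q x i j (k', c, h c).

Definition gx (x : dist R K) (i : I) (j : J) : R := \sum_k x k * g k i j.

Lemma kap_ge0 j x i c : 0 <= kap j x i c.
Proof.
by apply: sumr_ge0 => k' _; apply: sumr_ge0 => k _; rewrite mulr_ge0 // dist_ge0.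
Qed.

Lemma kap_sum1 j x i : \sum_c kap j x i c = 1.
Proof.
rewrite -(dist_sum1 x).
under eq_bigr do rewrite /kap /qext exchange_big /=.
rewrite exchange_big /=; apply: eq_bigr => k _; rewrite -[RHS]mulr1 -(qh k i j).
rewrite mulr_sumr; apply: eq_bigr => c _; rewrite mulr_sumr.
by [].
Qed.

Lemma gx_ge0 x i j : 0 <= gx x i j.
Proof. by apply: avg_ge => k; case/andP: (g01 k i j). Qed.

Lemma gx_le1 x i j : gx x i j <= 1.
Proof. by apply: avg_le => k; case/andP: (g01 k i j). Qed.

(** By [qh] the triples [(k', c, h c)] already carry mass one, so all the others are null. *)
Lemma sum_signals k i j (f : K * C * D -> R) :
  \sum_z q k i j z * f z =
  \sum_c \sum_k' q k i j (k', c, h c) * f (k', c, h c).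
Proof.
pose on (z : K * C * D) := z.2 == h z.1.2.
have reidx (f' : K * C * D -> R) :
    \sum_(z | on z) q k i j z * f' z = \sum_c \sum_k' q k i j (k', c, h c) * f' (k', c, h c).
  rewrite exchange_big pair_big /=.
  rewrite (reindex_onto (fun kc : K * C => (kc.1, kc.2, h kc.2)) (fun z => (z.1.1, z.1.2))) /=.
    by apply: eq_big => [[k' c]|[k' c]] //=; rewrite /on /= !eqxx.
  by move=> [[k' c] d]; rewrite /on /= => /eqP ->.
have off : \sum_(z | ~~ on z) q k i j z = 0.
  have := dist_sum1 (q k i j); rewrite (bigID on) /=.
  have -> : \sum_(z | on z) q k i j z = 1.
    rewrite -[RHS](qh k i j).
    transitivity (\sum_(z | on z) q k i j z * 1); first by apply: eq_bigr => z _; rewrite mulr1.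
    by rewrite (reidx (fun=> 1)); apply: eq_bigr => c _; apply: eq_bigr => k' _; rewrite mulr1.
  by move=> /eqP; rewrite addrC -subr_eq0 addrK => /eqP.
rewrite (bigID on) /= reidx [X in _ + X]big1 ?addr0 // => z nz.
have /eqP := off.
rewrite psumr_eq0; last by move=> *; exact: dist_ge0.
by move=> /allP /(_ z (mem_index_enum _)); rewrite nz /= => /eqP ->; rewrite mul0r.
Qed.

Lemma kapF j x i c k' : qext q x i j (k', c, h c) = kap j x i c * F x i c k'.
Proof. by rewrite qF mulrC. Qed.

(* By (A'3) the law of the pair (new belief, public signal) is the same for
   every action of player 2. *)
Lemma kap_indep j j' x i (f : dist R K -> D -> R) :
  \sum_c kap j x i c * f (F x i c) (h c) = \sum_c kap j' x i c * f (F x i c) (h c).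
Proof.
pose phi (z : dist R K * D) := f z.1 z.2.
have E jj : \sum_c kap jj x i c * f (F x i c) (h c) =
    \sum_(cd : C * D) qCD q x i jj cd * phi (F x i cd.1, cd.2).
  have qE c d : qCD q x i jj (c, d) * phi (F x i c, d) =
      \sum_k x k * \sum_(z | (z.1.2 == c) && (z.2 == d)) q k i jj z * phi (F x i z.1.2, z.2).
    rewrite /qCD mulr_suml; apply: eq_bigr => k _.
    rewrite mulr_suml mulr_sumr.
    rewrite (reindex_onto (fun k' => (k', c, d)) (fun z => z.1.1)) /=.
      by apply: eq_big => [k'|k' _]; rewrite ?eqxx // mulrA.
    by move=> [[k' c'] d'] /= /andP[/eqP -> /eqP ->].
  rewrite -(pair_bigA _ (fun c d => qCD q x i jj (c, d) * phi (F x i c, d))) /=.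
  under [RHS]eq_bigr do under eq_bigr do rewrite qE.
  rewrite pair_big exchange_big /=.
  under [RHS]eq_bigr do rewrite -mulr_sumr.
  transitivity (\sum_k x k * \sum_z q k i jj z * phi (F x i z.1.2, z.2)).
    under [RHS]eq_bigr do rewrite (sum_signals _ _ _ (fun z => phi (F x i z.1.2, z.2))) mulr_sumr.
    rewrite exchange_big /=; apply: eq_bigr => c _.
    rewrite /kap /qext exchange_big /= mulr_suml; apply: eq_bigr => k _.
    rewrite mulr_sumr mulr_suml; apply: eq_bigr => k' _.
    by rewrite mulrA.
  apply: eq_bigr => k _; congr (_ * _).
  rewrite (exchange_big_dep predT) //=; apply: eq_bigr => z _.
  rewrite (bigD1 (z.1.2, z.2)) /= ?eqxx // big1 ?addr0 // => -[c d] /= /andP[/andP[/eqP <- /eqP <-]].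
  by rewrite eqxx.
rewrite !E (sum_image _ (fun cd : C * D => (F x i cd.1, cd.2))).
rewrite [RHS](sum_image _ (fun cd : C * D => (F x i cd.1, cd.2))).
by apply: eq_bigr => z _; congr (_ * _); exact: qj.
Qed.

End Kernel.

Section Markov.
Variables (R : realType) (K I J C D : finType).
Variable g : K -> I -> J -> R.
Hypothesis g01 : forall k i j, 0 <= g k i j <= 1.
Variable q : K -> I -> J -> dist R (K * C * D).
Variable F : dist R K -> I -> C -> dist R K.
Hypothesis qF : condA1b q F.
Variable h : C -> D.
Hypothesis qh : forall k i j, \sum_c \sum_k' q k i j (k', c, h c) = 1.
Variables (i0 : I) (j0 : J).
Variable E : finType.

(* A public history [(e, s)] consists of player 2's initial information [e] and
   of the signals of player 2, the most recent first. *)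
Local Notation pub := (E * seq D)%type.
Local Notation strat := (pub -> dist R K -> dist R I).
Local Notation wlist := (seq (R * dist R K)).

Variable z0 : E -> wlist.
Hypothesis z0_ge0 : forall e, nng (z0 e).
Hypothesis z0_sum1 : \sum_e ig (z0 e) (fun=> 1) = 1.

(** Unnormalized Bayesian update: masses stay joint with the event that the new public signal is
    [d]. The reference action [j0] stands for every action of player 2, as [kap_indep] allows under
    (A'3). *)
Definition push (s : strat) (p : pub) (d : D) (z : wlist) : wlist :=
  [seq (a.1 * (s p a.2 ic.1 * (kap q h j0 a.2 ic.1 ic.2 * (h ic.2 == d)%:R)),
        F a.2 ic.1 ic.2) | a <- z, ic <- enum {: I * C}].

Fixpoint zrec (s : strat) (e : E) (r : seq D) : wlist :=
  if r is d :: r' then push s (e, r') d (zrec s e r') else z0 e.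
(* Joint law of the public history and of player 1's belief, when player 2 plays
   [j0] and player 1 uses [s]. *)
Definition zst (s : strat) (p : pub) : wlist := zrec s p.1 p.2.

Fixpoint pubs (n : nat) : seq pub :=
  if n is n'.+1 then [seq (p.1, d :: p.2) | p <- pubs n', d <- enum D]
  else [seq (e, [::]) | e <- enum E].

Lemma sum_pubs0 (f : pub -> R) : \sum_(p <- pubs 0) f p = \sum_e f (e, [::]).
Proof. by rewrite /= big_map big_enum. Qed.

Lemma sum_pubsS n (f : pub -> R) :
  \sum_(p <- pubs n.+1) f p = \sum_(p <- pubs n) \sum_d f (p.1, d :: p.2).
Proof.
by rewrite /= big_allpairs_dep; apply: eq_bigr => p _; rewrite big_enum.
Qed.

Lemma size_pubs n p : p \in pubs n -> size p.2 = n.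
Proof.
elim: n p => [|n IH] p /=; first by case/mapP => e _ ->.
by case/allpairsP => -[p' d] /= [/IH <- _ ->].
Qed.

Lemma ig_push s p d z f : ig (push s p d z) f =
  ig z (fun x => \sum_i s p x i * \sum_c kap q h j0 x i c * ((h c == d)%:R * f (F x i c))).
Proof.
rewrite /ig /push big_allpairs_dep; apply: eq_bigr => a _.
rewrite big_enum mulr_sumr /=; under [RHS]eq_bigr do rewrite !mulr_sumr.
by rewrite pair_big /=; apply: eq_bigr => -[i c] _ /=; ring.
Qed.

Lemma sum_push s p z (f : D -> dist R K -> R) :
  \sum_d ig (push s p d z) (f d) =
  ig z (fun x => \sum_i s p x i * \sum_c kap q h j0 x i c * f (h c) (F x i c)).
Proof.
under eq_bigr do rewrite ig_push.
rewrite -(ig_sum z _ predT (fun d x => _)); apply: eq_ig => x.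
rewrite exchange_big /=; apply: eq_bigr => i _; rewrite -mulr_sumr; congr (_ * _).
rewrite exchange_big /=; apply: eq_bigr => c _; rewrite -mulr_sumr; congr (_ * _).
rewrite (bigD1 (h c)) //= eqxx mul1r big1 ?addr0 // => d /negPf hd.
by rewrite eq_sym hd mul0r.
Qed.

Lemma nng_push s p d z : nng z -> nng (push s p d z).
Proof.
move=> /allP z_ge0; apply/allP => b /allpairsP[[a ic] /= [az _ ->]] /=.
by rewrite !mulr_ge0 ?dist_ge0 ?kap_ge0 ?z_ge0.
Qed.

Lemma nng_zst s p : nng (zst s p).
Proof.
by case: p => e; elim=> [|d r IH]; [exact: z0_ge0 | exact: nng_push].
Qed.

Lemma mass_zst s n : \sum_(p <- pubs n) ig (zst s p) (fun=> 1) = 1.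
Proof.
elim: n => [|n IH]; first by rewrite sum_pubs0.
rewrite sum_pubsS -[RHS]IH; apply: eq_bigr => p _.
rewrite /zst /= (sum_push _ _ _ (fun _ _ => 1)); apply: eq_ig => x.
rewrite -[RHS](dist_sum1 (s (p.1, p.2) x)); apply: eq_bigr => i _.
rewrite -[RHS]mulr1; congr (_ * _).
rewrite -[RHS](kap_sum1 qh j0 x i).
by apply: eq_bigr => c _; rewrite mulr1.
Qed.

Definition ag (n : nat) (s s' : strat) := forall p, (size p.2 < n)%N -> s p = s' p.

Lemma ag_zst n s s' p : ag n s s' -> (size p.2 <= n)%N -> zst s p = zst s' p.
Proof.
move=> ss; case: p => e; elim=> [//|d r IH] /= dr.
rewrite /zst /= -[zrec s' e r]/(zst s' (e, r)) -IH; last exact: ltnW.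
by rewrite /push (ss (e, r)).
Qed.

Definition gs (s : strat) (p : pub) (j : J) (x : dist R K) : R :=
  \sum_i s p x i * gx g x i j.

(** As [zst] is not affected by player 2, his best reply minimizes the current payoff separately at
    each public history. *)
Definition gam (s : strat) (l : nat) : R :=
  \sum_(p <- pubs l) minf j0 (fun j => ig (zst s p) (gs s p j)).

Lemma gs_ge0 s p j x : 0 <= gs s p j x.
Proof. by apply: avg_ge => i; exact: gx_ge0. Qed.

Lemma gs_le1 s p j x : gs s p j x <= 1.
Proof. by apply: avg_le => i; exact: gx_le1. Qed.

Lemma gam01 s l : 0 <= gam s l <= 1.
Proof.
apply/andP; split.
  apply: sumr_ge0 => p _; apply: minf_ge => j.
  by apply: ig_ge0 => [|x]; [exact: nng_zst | exact: gs_ge0].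
rewrite -(mass_zst s l); apply: ler_sum => p _.
apply: le_trans (minf_le _ _ j0) _.
by apply: ler_ig => [|x]; [exact: nng_zst | exact: gs_le1].
Qed.

Lemma ag_gam l s s' : ag l.+1 s s' -> gam s l = gam s' l.
Proof.
move=> ss; rewrite /gam [LHS]big_seq [RHS]big_seq; apply: eq_bigr => p /size_pubs pl.
apply: eq_minf => j; rewrite (ag_zst ss) ?pl //; apply: eq_ig => x.
by rewrite /gs (ss p) // pl.
Qed.

(** Diagonal limit: since [n] is strictly increasing, [u m.+1] is already final on the histories of
    length [m]. *)
Lemma ag_lim (u : nat -> strat) (n : nat -> nat) :
  (forall k, (n k < n k.+1)%N) -> (forall k, ag (n k) (u k) (u k.+1)) ->
  exists s, forall k, ag (n k) (u k) s.
Proof.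
move=> hn hu.
have mono k m : (n k <= n (k + m))%N.
  by elim: m => [|m IH]; [rewrite addn0 | rewrite addnS; have := hn (k + m)%N; lia].
have nk k : (k <= n k)%N by elim: k => [|k IH] //; have := hn k; lia.
have stable k m p : (size p.2 < n k)%N -> u k p = u (k + m)%N p.
  move=> pk; elim: m => [|m IH]; first by rewrite addn0.
  by rewrite addnS -(hu (k + m)%N) //; apply: leq_trans pk (mono k m).
exists (fun p => u (size p.2).+1 p) => k p pk.
have [le|/ltnW le] := leqP k (size p.2).+1.
  by rewrite (stable k ((size p.2).+1 - k)%N) // subnKC.
by rewrite [RHS](stable _ (k - (size p.2).+1)%N) ?subnKC.
Qed.

(** * Prices on the actions of player 2, and best replies of player 1 to them *)

Section Prices.
Variable pi : pub -> J -> R.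
Hypothesis pi_ge0 : forall p j, 0 <= pi p j.

Definition tr (xi : K -> R) (i : I) (c : C) (k' : K) : R :=
  \sum_k xi k * q k i j0 (k', c, h c).

(* Best reply of player 1 to the prices [pi]; the measure [xi] on states is not
   normalized, which makes the recursion linear in the signal. *)
Fixpoint reply_val (n : nat) (xi : K -> R) (p : pub) : R :=
  if n is n'.+1 then maxf i0 (fun i =>
    \sum_j pi p j * (\sum_k xi k * g k i j) +
    \sum_c reply_val n' (tr xi i c) (p.1, h c :: p.2))
  else 0.

Lemma reply_valZ n xi p a : 0 <= a -> reply_val n (fun k => a * xi k) p = a * reply_val n xi p.
Proof.
move=> a0; elim: n xi p => [|n IH] xi p /=; first by rewrite mulr0.
rewrite -maxfZ //; apply: eq_maxf => i; rewrite mulrDr; congr (_ + _).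
  rewrite mulr_sumr; apply: eq_bigr => j _; rewrite mulrCA; congr (_ * _).
  by rewrite mulr_sumr; apply: eq_bigr => k _; rewrite mulrA.
rewrite mulr_sumr; apply: eq_bigr => c _; rewrite -IH; congr reply_val; apply: funext => k'.
by rewrite /tr mulr_sumr; apply: eq_bigr => k _; rewrite mulrA.
Qed.

Definition reply_step n (x : dist R K) p i : R :=
  \sum_j pi p j * gx g x i j +
  \sum_c kap q h j0 x i c * reply_val n (F x i c) (p.1, h c :: p.2).

Lemma reply_valS n (x : dist R K) p : reply_val n.+1 x p = maxf i0 (reply_step n x p).
Proof.
rewrite /=; apply: eq_maxf => i; congr (_ + _).
apply: eq_bigr => c _; rewrite -reply_valZ ?kap_ge0 //; congr reply_val; apply: funext => k'.
by rewrite -(kapF qF).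
Qed.

Variable Th : nat -> R.
Hypothesis Th_ge0 : forall l, 0 <= Th l.

Lemma sum_tr_norm (xi xi' : K -> R) i :
  \sum_c \sum_k' `|tr xi i c k' - tr xi' i c k'| <= \sum_k `|xi k - xi' k|.
Proof.
have -> : \sum_k `|xi k - xi' k| =
    \sum_c \sum_k' \sum_k `|xi k - xi' k| * q k i j0 (k', c, h c).
  under [RHS]eq_bigr do rewrite exchange_big /=.
  rewrite exchange_big /=; apply: eq_bigr => k _; rewrite -[LHS]mulr1 -(qh k i j0).
  by rewrite mulr_sumr; apply: eq_bigr => c _; rewrite mulr_sumr.
apply: ler_sum => c _; apply: ler_sum => k' _; rewrite /tr -sumrB.
apply: le_trans (ler_norm_sum _ _ _) _; apply: ler_sum => k _.
by rewrite -mulrBl normrM (ger0_norm (dist_ge0 _ _)).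
Qed.

(** Transitions do not increase the l1 distance and payoffs lie in the unit interval, so each stage
    contributes at most its price times the initial distance. The constant depends on the total
    price and not on the horizon. *)
Lemma reply_val_lipschitz n xi xi' p :
  (forall p', (size p'.2 < size p.2 + n)%N -> \sum_j pi p' j <= Th (size p'.2)) ->
  reply_val n xi p - reply_val n xi' p <= wsum Th (size p.2) n * \sum_k `|xi k - xi' k|.
Proof.
elim: n xi xi' p => [|n IH] xi xi' p hTh; first by rewrite /= subrr wsum0 mul0r.
rewrite /= lerBlDr; apply: maxf_le => i; rewrite -lerBlDr.
apply: le_trans (lerB (lexx _) (maxf_ge _ _ i)) _.
rewrite opprD addrACA (wsumD Th (size p.2) 1 n) mulrDl lerD //.
  rewrite -sumrB {1}/wsum big_ord1 addn0.
  have : \sum_j pi p j <= Th (size p.2) by apply: hTh; lia.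
  move=> hp; apply: le_trans (ler_wpM2r (sumr_ge0 _ _) hp) => //.
  rewrite mulr_suml; apply: ler_sum => j _.
  rewrite -mulrBr ler_wpM2l // -sumrB; apply: ler_sum => k _.
  rewrite -mulrBl; apply: le_trans (ler_norm _) _; rewrite normrM ler_piMr //.
  by have /andP[? ?] := g01 k i j; rewrite ger0_norm.
rewrite -sumrB addn1.
apply: (@le_trans _ _ (\sum_c wsum Th (size p.2).+1 n *
    \sum_k' `|tr xi i c k' - tr xi' i c k'|)).
  apply: ler_sum => c _; apply: (IH _ _ (p.1, h c :: p.2)) => p' /= hp.
  by apply: hTh; lia.
rewrite -mulr_sumr; apply: ler_wpM2l; last exact: sum_tr_norm.
exact: sumr_ge0.
Qed.

Lemma reply_val_ge0 n (x : dist R K) p : 0 <= reply_val n x p.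
Proof.
elim: n x p => [|n IH] x p //; rewrite reply_valS; apply: le_trans (maxf_ge _ _ i0).
by apply: addr_ge0; apply: sumr_ge0 => ? _; rewrite mulr_ge0 ?gx_ge0 ?kap_ge0.
Qed.

Lemma reply_val_le n (x : dist R K) p :
  (forall p', (size p'.2 < size p.2 + n)%N -> \sum_j pi p' j <= Th (size p'.2)) ->
  reply_val n x p <= wsum Th (size p.2) n.
Proof.
elim: n x p => [|n IH] x p hTh; first by rewrite wsum0.
rewrite reply_valS; apply: maxf_le => i; rewrite (wsumD Th (size p.2) 1 n) lerD //.
  rewrite {1}/wsum big_ord1 addn0; apply: le_trans (hTh p _); last by lia.
  by apply: ler_sum => j _; rewrite ler_piMr // gx_le1.
rewrite -[leRHS]mul1r -(kap_sum1 qh j0 x i) mulr_suml; apply: ler_sum => c _.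
apply: ler_wpM2l; first exact: kap_ge0.
rewrite addn1; apply: (IH _ (p.1, h c :: p.2)) => p' /= hp.
by apply: hTh; lia.
Qed.

(** Used to extend the horizon from the end of one block to the end of the whole game. *)
Lemma reply_val_pad n m (x : dist R K) p :
  (forall p', (size p.2 + n <= size p'.2)%N -> forall j, pi p' j = 0) ->
  reply_val (n + m) x p = reply_val n x p.
Proof.
elim: n x p => [|n IH] x p hpi.
  elim: m x p hpi => [//|m IHm] x p hpi; rewrite add0n reply_valS /reply_step.
  rewrite (eq_maxf i0 (f' := fun=> 0)); first by have [? ->] := maxf_ex i0 (fun=> 0 : R).
  move=> i; rewrite big1 ?add0r => [|j _]; last by rewrite hpi ?mul0r ?addn0.
  rewrite big1 // => c _; rewrite -[m]add0n IHm ?mulr0 // => p' /= hp; apply: hpi; lia.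
rewrite addSn !reply_valS; apply: eq_maxf => i; congr (_ + _); apply: eq_bigr => c _.
by rewrite IH // => p' /= hp; apply: hpi; lia.
Qed.

(* Value of the stages [l], ..., [l + n - 1], weighted by [Th], from the public
   history [p] on, when player 2 plays a stagewise best reply. *)
Fixpoint min_val (s : strat) (l n : nat) (z : wlist) (p : pub) : R :=
  if n is n'.+1 then
    Th l * minf j0 (fun j => ig z (gs s p j)) +
    \sum_d min_val s l.+1 n' (push s p d z) (p.1, d :: p.2)
  else 0.

(** The clock [l] of the weights and the clock [m] of the play are independent, so that a
    continuation can be evaluated with weights designed for another starting stage. *)
Lemma sum_min_val s l n m : \sum_(p <- pubs m) min_val s l n (zst s p) p =
  \sum_(u < n) Th (l + u)%N * gam s (m + u).
Proof.
elim: n l m => [|n IH] l m /=; first by rewrite big1 // big_ord0.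
rewrite big_split /= big_ord_recl !addn0 /=; congr (_ + _).
  by rewrite /gam mulr_sumr.
transitivity (\sum_(p <- pubs m.+1) min_val s l.+1 n (zst s p) p).
  by rewrite sum_pubsS; apply: eq_bigr => -[e r] _.
rewrite IH.
by apply: eq_bigr => u _; rewrite /bump /= !add1n !addSnnS.
Qed.

(** Weak duality: the prices are a weighted mixed action, hence pay at least the minimum over [j],
    and a best reply pays at least as much as [s]. The strategy is followed at [pt] while prices are
    read at [p], so prices can be borrowed from another history. *)
Lemma min_val_le_reply s n z pt p : nng z ->
  (forall p', (size p.2 <= size p'.2 < size p.2 + n)%N ->
     \sum_j pi p' j = Th (size p'.2)) ->
  min_val s (size p.2) n z pt <= ig z (fun x => reply_val n x p).
Proof.
elim: n z pt p => [|n IH] z pt p z_ge0 hTh; first by rewrite ig0.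
rewrite [leLHS]/=; set mi := minf _ _.
apply: (@le_trans _ _ (ig z (fun x => \sum_i s pt x i * reply_step n x p i))); last first.
  by apply: ler_ig => // x; rewrite reply_valS; apply: avg_le => i; exact: maxf_ge.
have -> : ig z (fun x => \sum_i s pt x i * reply_step n x p i) =
    \sum_j pi p j * ig z (gs s pt j) +
    \sum_d ig (push s pt d z) (fun x => reply_val n x (p.1, d :: p.2)).
  rewrite (sum_push s pt z (fun d x => reply_val n x (p.1, d :: p.2))).
  under eq_bigr do rewrite -igZ.
  rewrite -(ig_sum z _ predT (fun j x => _)) -igD; apply: eq_ig => x.
  under [X in X + _]eq_bigr do rewrite mulr_sumr.
  rewrite exchange_big -big_split; apply: eq_bigr => i _ /=.
  rewrite /reply_step mulrDr; congr (_ + _); rewrite mulr_sumr; apply: eq_bigr => j _.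
  by rewrite mulrCA.
apply: lerD.
  rewrite -(hTh p) ?leqnn ?ltnS /= ; last by lia.
  by rewrite mulr_suml; apply: ler_sum => j _; rewrite ler_wpM2l // minf_le.
apply: ler_sum => d _; apply: (IH _ _ (p.1, d :: p.2)); first exact: nng_push.
by move=> p' /= hp; apply: hTh; lia.
Qed.

Definition spay (s : strat) (l : nat) : R :=
  \sum_(p <- pubs l) ig (zst s p) (fun x => \sum_i s p x i * \sum_j pi p j * gx g x i j).

Lemma reply_val_attained s m n : exists2 s', ag m s s' &
  \sum_(p <- pubs m) ig (zst s p) (fun x => reply_val n x p) = wsum (spay s') m n.
Proof.
(* At a history of length [l] in the window, [m + n - l.+1] stages remain after the current one. *)
pose br (p : pub) (x : dist R K) : I :=
  [arg max_(i > i0) reply_step (m + n - (size p.2).+1) x p i]%O.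
pose s' (p : pub) x := if (size p.2 < m)%N then s p x else dirac_dist R (br p x).
have ss' : ag m s s' by move=> p pm; apply: funext => x; rewrite /s' pm.
exists s' => //.
transitivity (\sum_(p <- pubs m) ig (zst s' p) (fun x => reply_val n x p)).
  rewrite [LHS]big_seq [RHS]big_seq; apply: eq_bigr => p /size_pubs pm.
  by rewrite (ag_zst ss') ?pm.
have main n' m' : (m <= m')%N -> (m' + n' = m + n)%N ->
    \sum_(p <- pubs m') ig (zst s' p) (fun x => reply_val n' x p) = wsum (spay s') m' n'.
  elim: n' m' => [|n' IH] m' mm' e.
    by rewrite wsum0 big1 // => p _; rewrite ig0.
  rewrite (wsumD _ m' 1 n') {1}/wsum big_ord1 addn0 addn1 -IH; [|lia|lia].
  rewrite sum_pubsS -big_split /= [LHS]big_seq [RHS]big_seq; apply: eq_bigr => p /size_pubs pm.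
  rewrite /zst /= (sum_push _ _ _ (fun d x => reply_val n' x (p.1, d :: p.2))) -igD.
  apply: eq_ig => x; rewrite -[maxf _ _]/(reply_val n'.+1 x p) reply_valS.
  have -> : maxf i0 (reply_step n' x p) = \sum_i s' p x i * reply_step n' x p i.
    rewrite /s' pm ltnNge mm' /= sum_dirac_dist /br pm.
    by have -> : (m + n - m'.+1 = n')%N by lia.
  rewrite -big_split; apply: eq_bigr => i _ /=.
  by rewrite -surjective_pairing mulrDr.
exact: main.
Qed.

End Prices.
End Markov.

(** * Duality between strategies of player 1 and prices *)

Section Duality.
Variables (R : realType) (K I J C D : finType).
Variable g : K -> I -> J -> R.
Hypothesis g01 : forall k i j, 0 <= g k i j <= 1.
Variable q : K -> I -> J -> dist R (K * C * D).
Variable F : dist R K -> I -> C -> dist R K.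
Variable h : C -> D.
Hypothesis qh : forall k i j, \sum_c \sum_k' q k i j (k', c, h c) = 1.
Variable j0 : J.
Variable E : finType.

Local Notation pub := (E * seq D)%type.
Local Notation strat := (pub -> dist R K -> dist R I).
Local Notation wlist := (seq (R * dist R K)).

Variable z0 : E -> wlist.
Hypothesis z0_ge0 : forall e, nng (z0 e).
Hypothesis z0_sum1 : \sum_e ig (z0 e) (fun=> 1) = 1.

Local Notation zst := (zst q F h j0 z0).
Local Notation gam := (gam g q F h j0 z0).
Local Notation spay := (spay g q F h j0 z0).
Local Notation gs := (gs g).
Local Notation pubs := (@pubs D E).

(* Behavior strategies realizing a mixture: the conditional law of the action
   given the public history and the belief. *)
Lemma mix_strat n (s s1 s2 : strat) (a : R) : 0 <= a <= 1 ->
  ag n s s1 -> ag n s s2 ->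
  exists2 s3, ag n s s3 & forall p (f : I -> dist R K -> R),
    ig (zst s3 p) (fun x => \sum_i s3 p x i * f i x) =
    a * ig (zst s1 p) (fun x => \sum_i s1 p x i * f i x) +
    (1 - a) * ig (zst s2 p) (fun x => \sum_i s2 p x i * f i x).
Proof.
move=> /andP[a0 a1] ss1 ss2.
have {}a1 : 0 <= 1 - a by rewrite subr_ge0.
pose m1 p x := a * ig (zst s1 p) (fun y => (y == x)%:R).
pose m2 p x := (1 - a) * ig (zst s2 p) (fun y => (y == x)%:R).
have m1_ge0 p x : 0 <= m1 p x by rewrite mulr_ge0 // ig_ge0 // nng_zst.
have m2_ge0 p x : 0 <= m2 p x by rewrite mulr_ge0 // ig_ge0 // nng_zst.
pose s3 p x := if (size p.2 < n)%N then s p x else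
  mkdist (s1 p x) (fun i => (m1 p x * s1 p x i + m2 p x * s2 p x i) / (m1 p x + m2 p x)).
have ss3 : ag n s s3 by move=> p pn; apply: funext => x; rewrite /s3 pn.
exists s3 => // -[e r].
have main r' : (forall f, ig (zst s3 (e, r')) f =
      a * ig (zst s1 (e, r')) f + (1 - a) * ig (zst s2 (e, r')) f) ->
    forall f, ig (zst s3 (e, r')) (fun x => \sum_i s3 (e, r') x i * f i x) =
    a * ig (zst s1 (e, r')) (fun x => \sum_i s1 (e, r') x i * f i x) +
    (1 - a) * ig (zst s2 (e, r')) (fun x => \sum_i s2 (e, r') x i * f i x).
  move=> IH f; set p := (e, r').
  have [pn|pn] := ltnP (size p.2) n.
    rewrite -(ag_zst _ _ _ _ _ ss3 (ltnW pn)) -(ag_zst _ _ _ _ _ ss1 (ltnW pn)).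
    rewrite -(ag_zst _ _ _ _ _ ss2 (ltnW pn)).
    by rewrite -ss3 // -ss1 // -ss2 // -mulrDl addrC subrK mul1r.
  rewrite IH -/p.
  pose u := undup (map snd (zst s1 p ++ zst s2 p)).
  have u1 : {subset map snd (zst s1 p) <= u}.
    by move=> x; rewrite mem_undup map_cat mem_cat => ->.
  have u2 : {subset map snd (zst s2 p) <= u}.
    by move=> x; rewrite mem_undup map_cat mem_cat orbC => ->.
  rewrite !(ig_atoms _ (undup_uniq _) u1) !(ig_atoms _ (undup_uniq _) u2).
  rewrite !mulr_sumr -!big_split /=; apply: eq_bigr => x _.
  rewrite !mulrA -/(m1 p x) -/(m2 p x) -mulrDl !mulr_sumr -big_split /=.
  apply: eq_bigr => i _; rewrite !mulrA -mulrDl; congr (_ * _).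
  rewrite /s3 ltnNge pn /=.
  have [m0|m0] := eqVneq (m1 p x + m2 p x) 0.
    have /eqP := m0; rewrite paddr_eq0 // => /andP[/eqP -> /eqP ->].
    by rewrite addr0 !mul0r addr0.
  rewrite mkdistE; first by rewrite mulrC divfK.
    by move=> i'; apply: divr_ge0; apply: addr_ge0 => //; rewrite mulr_ge0 ?dist_ge0.
  rewrite -mulr_suml big_split /= -!mulr_sumr !dist_sum1 !mulr1 divff //.
apply: (main r); elim: r => [|d r IH] f; first by rewrite -mulrDl addrC subrK mul1r.
by rewrite /zst /= !ig_push; exact: main.
Qed.

(** [approx_minimax] is applied to the payoff vectors of the strategies extending [s0], indexed by
    pairs of an evaluation [t] and a map from public histories to actions. Such maps do not affect
    [zst], so a mixture of pairs acts only through its total weight on each history and action: the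
    price [pi]. *)
Lemma exists_prices n0 n (s0 : strat) (T : finType) (th : T -> nat -> R) (v e : R) :
  (forall t l, 0 <= th t l) -> 0 < e ->
  (forall s, ag n0 s0 s -> exists t, wsum (fun l => th t l * gam s l) n0 n <= v) ->
  exists (bt : T -> R) (pi : pub -> J -> R),
    [/\ forall t, 0 <= bt t, \sum_t bt t = 1, forall p j, 0 <= pi p j,
      forall p, \sum_j pi p j = \sum_t bt t * th t (size p.2) &
      forall s, ag n0 s0 s -> wsum (spay pi s) n0 n <= v + e].
Proof.
move=> th0 e0 hv.
pose L := (n0 + n)%N.
(* Bounding the length of histories by [L] makes the set of replies finite; longer histories get a
   default code and do not occur in the window. *)
pose B : finType := (T * {ffun E * L.-bseq D -> J})%type.
pose ins (p : pub) : E * L.-bseq D := (p.1, insub_bseq L p.2).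
pose pay (s : strat) (b : {ffun E * L.-bseq D -> J}) l :=
  \sum_(p <- pubs l) ig (zst s p) (gs s p (b (ins p))).
pose u (s : strat) (tb : B) := wsum (fun l => th tb.1 l * pay s tb.2 l) n0 n.
pose U := [set u s | s in [set s | ag n0 s0 s]]%classic.
have pay01 s b l : 0 <= pay s b l <= 1.
  apply/andP; split.
    by apply: sumr_ge0 => p _; rewrite ig_ge0 ?nng_zst // => x; exact: gs_ge0.
  rewrite -(mass_zst F qh j0 z0_sum1 s l); apply: ler_sum => p _.
  by apply: ler_ig => [|x]; [exact: nng_zst | exact: gs_le1].
have [|||||beta [b0 b1 hb]] := @approx_minimax R B U (\sum_t wsum (th t) n0 n) v e.
- move=> _ _ a [s1 /= ss1 <-] [s2 /= ss2 <-] a01.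
  have [s3 ss3 h3] := mix_strat a01 ss1 ss2.
  exists s3 => //; apply: funext => -[t b]; rewrite /u /wsum !mulr_sumr -big_split.
  apply: eq_bigr => l _ /=; rewrite mulrCA (mulrCA (1 - a)) -mulrDr; congr (_ * _).
  rewrite /pay !mulr_sumr -big_split; apply: eq_bigr => p _ /=.
  exact: (h3 p (fun i x => gx g x i (b (ins p)))).
- move=> _ [t b] [s _ <-]; rewrite ger0_norm; last first.
    apply: sumr_ge0 => l _; rewrite mulr_ge0 //.
    by have /andP[] := pay01 s b (n0 + l)%N.
  rewrite (bigD1 t) //= -[leLHS]addr0; apply: lerD.
    apply: ler_sum => l _; rewrite ler_piMr //.
    by have /andP[] := pay01 s b (n0 + l)%N.
  by apply: sumr_ge0 => t' _; exact: sumr_ge0.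
- by exists (u s0), s0.
- move=> _ [s /= ss <-]; have [t ht] := hv s ss.
  pose b := [ffun y : E * L.-bseq D =>
     [arg min_(j < j0) ig (zst s (y.1, val y.2)) (gs s (y.1, val y.2) j)]%O].
  exists (t, b); apply: le_trans ht; apply: ler_sum => l _.
  rewrite ler_wpM2l // le_eqVlt; apply/orP; left; apply/eqP.
  rewrite /pay /gam [LHS]big_seq [RHS]big_seq; apply: eq_bigr => p /size_pubs pl.
  rewrite /minf ffunE /= /insub_bseq insubdK -?surjective_pairing //.
  rewrite unfold_in pl; have := ltn_ord l; rewrite /L; lia.
- by [].
pose pi (p : pub) j := \sum_t th t (size p.2) *
  \sum_(b : {ffun E * L.-bseq D -> J} | b (ins p) == j) beta (t, b).
exists (fun t => \sum_(b : {ffun E * L.-bseq D -> J}) beta (t, b)), pi; split.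
- by move=> t; exact: sumr_ge0.
- by rewrite pair_bigA /= -b1; apply: eq_bigr => -[].
- by move=> p j; apply: sumr_ge0 => t _; rewrite mulr_ge0 ?sumr_ge0.
- move=> p; rewrite exchange_big /=; apply: eq_bigr => t _.
  rewrite -mulr_sumr mulrC; congr (_ * _); rewrite (exchange_big_dep predT) //=.
  by apply: eq_bigr => b _; rewrite (big_pred1 (b (ins p))) // => j; rewrite eq_sym.
move=> s ss; have hu : U (u s) by exists s.
apply: le_trans (hb _ hu); rewrite le_eqVlt; apply/orP; left; apply/eqP.
rewrite /u /wsum; under [RHS]eq_bigr do rewrite mulr_sumr.
rewrite exchange_big /=; apply: eq_bigr => l _; rewrite /spay /pay.
under [RHS]eq_bigr do rewrite mulrA mulr_sumr.
rewrite exchange_big /= [LHS]big_seq [RHS]big_seq; apply: eq_bigr => p /size_pubs pl.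
pose A j := ig (zst s p) (gs s p j).
transitivity (\sum_j pi p j * A j).
  under [RHS]eq_bigr do rewrite -igZ.
  rewrite -(ig_sum _ _ predT (fun j x => _)); apply: eq_ig => x.
  under eq_bigr do rewrite mulr_sumr.
  rewrite exchange_big /=; apply: eq_bigr => j _; rewrite mulr_sumr.
  by apply: eq_bigr => i _; rewrite mulrCA.
transitivity (\sum_t \sum_(b : {ffun E * L.-bseq D -> J})
    beta (t, b) * th t (n0 + l)%N * A (b (ins p))); last first.
  by rewrite pair_bigA; apply: eq_bigr => -[t b] _; rewrite /= ?mulrA.
under eq_bigr do rewrite mulr_suml.
rewrite exchange_big /=; apply: eq_bigr => t _; rewrite pl.
under eq_bigr do rewrite -mulrA mulr_suml mulr_sumr.
rewrite (exchange_big_dep predT) //=; apply: eq_bigr => b _.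
rewrite (big_pred1 (b (ins p))); last first.
  by move=> j; rewrite eq_sym.
by rewrite mulrA; congr (_ * _); rewrite mulrC.
Qed.
End Duality.

(** * Discretization of the state space *)

Section Quantization.
Variable R : realType.

Lemma unit_interval_cells (d : R) : 0 < d ->
  exists (T : finType) (c : R -> T), forall t t' : R, 0 <= t <= 1 -> 0 <= t' <= 1 ->
    c t = c t' -> `|t - t'| <= d.
Proof.
move=> d0; have [M hM] := ex_nat_ge d^-1.
have M0 : 0 < M%:R :> R by apply: lt_le_trans hM; rewrite invr_gt0.
pose n (t : R) := Num.truncn (t * M%:R).
exists 'I_M.+1, (fun t => inord (n t)) => t t' ht ht' /(congr1 (@nat_of_ord _)).
have nM s : 0 <= s <= 1 -> (n s <= M)%N /\ (n s)%:R <= s * M%:R < (n s)%:R + 1.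
  move=> /andP[s0 s1]; have /truncn_itv : 0 <= s * M%:R by rewrite mulr_ge0 // ltW.
  rewrite -/(n s) -natr1 => hs; split=> //; rewrite -(ler_nat R).
  have /andP[h1 _] := hs; apply: le_trans h1 _.
  by rewrite ler_piMl // ltW.
have [t1 /andP[t2 t3]] := nM _ ht; have [t1' /andP[t2' t3']] := nM _ ht'.
rewrite !inordK // => e; rewrite e in t2 t3.
have dM : 1 <= d * M%:R by rewrite mulrC -ler_pdivrMr ?div1r.
have : `|t - t'| * M%:R <= 1.
  rewrite -(ger0_norm (ltW M0)) -normrM mulrBl ler_norml.
  by apply/andP; split; lra.
move=> /le_trans /(_ dM); by rewrite ler_pM2r.
Qed.

Lemma simplex_cells (K : finType) (d : R) : 0 < d ->
  exists (G : finType) (c : dist R K -> G), forall x x',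
    c x = c x' -> \sum_k `|x k - x' k| <= d.
Proof.
move=> d0.
have d1 : 0 < d / (#|K|%:R + 1) by rewrite divr_gt0 // ltr_wpDl.
have [T [c hc]] := unit_interval_cells d1.
exists {ffun K -> T}, (fun x => [ffun k => c (x k)]) => x x' /ffunP e.
have x01 (y : dist R K) k : 0 <= y k <= 1.
  rewrite dist_ge0 -(dist_sum1 y) (bigD1 k) //= lerDl sumr_ge0 // => *; exact: dist_ge0.
apply: (@le_trans _ _ (\sum_(k : K) d / (#|K|%:R + 1))).
  by apply: ler_sum => k _; apply: hc => //; have := e k; rewrite !ffunE.
rewrite sumr_const -[leLHS]mulr_natr mulrAC ler_pdivrMr ?ltr_wpDl //.
by rewrite ler_wpM2l ?lerDl // ltW.
Qed.

Section Families.
Variables (X : choiceType) (G : finType) (c : X -> G).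
Local Notation wlist := (seq (R * X)).
Implicit Types (z : wlist) (f : X -> R).

Definition mass z := ig z (fun=> 1).
Definition cellm z (a : G) := ig z (fun x => (c x == a)%:R).

Lemma mass_ge0 z : nng z -> 0 <= mass z.
Proof. by move=> z0; apply: ig_ge0. Qed.

Lemma ig_cells z (w : G -> R) : ig z (fun x => w (c x)) = \sum_a cellm z a * w a.
Proof.
under eq_bigr do rewrite mulrC -igZ.
rewrite -(ig_sum z _ predT (fun a x => _)); apply: eq_ig => x.
rewrite (bigD1 (c x)) //= eqxx mulr1 big1 ?addr0 // => a /negPf h.
by rewrite eq_sym h mulr0.
Qed.

(** Replacing [f] by a function [w] of the cell costs [d0] on each side; the normalized integrals of
    [w] then differ by at most [d1] per cell. *)
Lemma ig_le_of_cells z z' f (d0 d1 : R) : nng z -> nng z' ->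
  0 < mass z -> 0 < mass z' -> 0 <= d0 ->
  (forall a, `|cellm z' a / mass z' - cellm z a / mass z| <= d1) ->
  (forall x, 0 <= f x <= 1) -> (forall x x', c x = c x' -> f x - f x' <= d0) ->
  ig z' f <= mass z' * (ig z f / mass z + (2 * d0 + #|G|%:R * d1)).
Proof.
move=> z0 z0' m0 m0' d0_ge0 hd f01 fc.
have [w hw] : exists w : G -> R, forall a,
    0 <= w a <= 1 /\ forall x, c x = a -> `|f x - w a| <= d0.
  suff ex a : exists wa, 0 <= wa <= 1 /\ forall x, c x = a -> `|f x - wa| <= d0.
    by have [w hw] := choice ex; exists w.
  have [[x hx]|nx] := pselect (exists x, c x = a); last first.
    by exists 0; split=> [|x cx]; [rewrite lexx ler01 | case: nx; exists x].
  exists (f x); split=> // x' hx'; rewrite ler_norml; apply/andP; split.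
    by rewrite lerNl opprB; apply: fc; rewrite hx.
  by apply: fc; rewrite hx.
have w1 x : f x <= w (c x) + d0.
  by have [_ /(_ x erefl)] := hw (c x); rewrite ler_norml => /andP[]; lra.
have w2 x : w (c x) <= f x + d0.
  by have [_ /(_ x erefl)] := hw (c x); rewrite ler_norml => /andP[]; lra.
rewrite -ler_pdivrMl // mulrC.
have h1 : ig z' f / mass z' <= ig z' (fun x => w (c x)) / mass z' + d0.
  rewrite ler_pdivrMr // mulrDl divfK ?gt_eqF // mulrC -ig_cst -igD.
  exact: ler_ig.
have h2 : ig z (fun x => w (c x)) / mass z <= ig z f / mass z + d0.
  rewrite ler_pdivrMr // mulrDl divfK ?gt_eqF // [d0 * _]mulrC -ig_cst -igD.
  exact: ler_ig.
have h3 : ig z' (fun x => w (c x)) / mass z' <= ig z (fun x => w (c x)) / mass z + #|G|%:R * d1.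
  rewrite !ig_cells !mulr_suml -lerBlDl -sumrB mulr_natl -sumr_const.
  apply: ler_sum => a _; rewrite mulrAC [X in _ - X]mulrAC -mulrBl.
  apply: le_trans (hd a); apply: le_trans (ler_norm _) _.
  rewrite normrM ler_piMr // ger0_norm; first by have [/andP[]] := hw a.
  by have [/andP[]] := hw a.
by lra.
Qed.

Lemma ig_unit z f : nng z -> (forall x, 0 <= f x <= 1) -> 0 <= ig z f <= mass z.
Proof.
move=> z0 f01; rewrite ig_ge0 //=; last by move=> x; case/andP: (f01 x).
by apply: ler_ig => // x; case/andP: (f01 x).
Qed.

Lemma cell_ratio01 z a : nng z -> 0 <= cellm z a / mass z <= 1.
Proof.
move=> z0; have /andP[h1 h2] : 0 <= cellm z a <= mass z.
  by apply: ig_unit => // x; case: eqP; rewrite lexx ler01.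
rewrite divr_ge0 ?mass_ge0 //=.
have := mass_ge0 z0; rewrite le_eqVlt => /orP[/eqP <-|m0]; first by rewrite invr0 mulr0.
by rewrite ler_pdivrMr // mul1r.
Qed.

Variables (A : eqType) (T T' : finType) (cT : R -> T) (cT' : R -> T') (d0 d1 d2 : R).
Hypothesis d0_ge0 : 0 <= d0.
Hypothesis cTP : forall t t' : R, 0 <= t <= 1 -> 0 <= t' <= 1 -> cT t = cT t' -> `|t - t'| <= d1.
Hypothesis cTP' : forall t t' : R, 0 <= t <= 1 -> 0 <= t' <= 1 -> cT' t = cT' t' -> `|t - t'| <= d2.

Definition dir z : {ffun G -> T} := [ffun a => cT (cellm z a / mass z)].

Definition dirm (P : seq A) (z : A -> wlist) (b : {ffun G -> T}) :=
  \sum_(p <- P | dir (z p) == b) mass (z p).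

(* Three levels of discretization: beliefs of player 1, conditional laws of this
   belief given the public history, and the law of these conditional laws. *)
Definition quantize (P : seq A) (z : A -> wlist) : {ffun {ffun G -> T} -> T'} :=
  [ffun b => cT' (dirm P z b)].

Lemma dirm01 (P : seq A) (z : A -> wlist) b : (forall p, nng (z p)) ->
  \sum_(p <- P) mass (z p) = 1 -> 0 <= dirm P z b <= 1.
Proof.
move=> z0 <-; apply/andP; split; first by apply: sumr_ge0 => p _; exact: mass_ge0.
rewrite (bigID (fun p => dir (z p) == b)) /= lerDl.
by apply: sumr_ge0 => p _; exact: mass_ge0.
Qed.

(** To [p'] is assigned a history of [P] whose normalized measure lies in the same cell and which
    minimizes the normalized integral of [f] there. Equal codes make the total masses of each cell
    close in both families. *)
Lemma code_transport (P P' : seq A) (z z' : A -> wlist) (f : A -> X -> R) :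
  (forall p, nng (z p)) -> (forall p, nng (z' p)) ->
  \sum_(p <- P) mass (z p) = 1 -> \sum_(p <- P') mass (z' p) = 1 ->
  quantize P z = quantize P' z' ->
  (forall p x, 0 <= f p x <= 1) ->
  (forall p x x', c x = c x' -> f p x - f p x' <= d0) ->
  exists2 r : A -> A, forall p', r p' \in P &
    \sum_(p <- P') ig (z' p) (f (r p)) <=
    \sum_(p <- P) ig (z p) (f p) +
      (2 * d0 + #|G|%:R * d1 + #|{ffun G -> T}|%:R * d2).
Proof.
move=> z0 z0' z1 z1' /ffunP codeE f01 fc.
have d1_ge0 : 0 <= d1 by apply: le_trans (cTP (t := 0) (t' := 0) _ _ erefl); rewrite ?lexx ?ler01.
pose err := 2 * d0 + #|G|%:R * d1.
have err0 : 0 <= err by rewrite addr_ge0 // mulr_ge0.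
have [pP PpP] : exists p, p \in P.
  case: P z1 {codeE} => [|p P]; last by exists p; rewrite mem_head.
  by rewrite big_nil => /eqP; rewrite eq_sym oner_eq0.
(* [pm.1] and [pm.2]: a history minimizing the normalized integral of [f] in
   the cell [b], and this minimum. *)
have opt b : exists pm : A * R, [/\ pm.1 \in P, 0 <= pm.2 <= 1,
    forall p, p \in P -> dir (z p) == b -> mass (z p) * pm.2 <= ig (z p) (f p) &
    forall p', dir (z' p') == b ->
      ig (z' p') (f pm.1) <= mass (z' p') * (pm.2 + err)].
  pose Q := [seq p <- P | (dir (z p) == b) && (0 < mass (z p))].
  pose nf p := ig (z p) (f p) / mass (z p).
  case Qe : Q => [|p0 Q'].
    (* The first family has no mass in this cell: any history and the trivial bound 1 will do. *)
    exists (pP, 1); split=> //=; first by rewrite ler01 lexx.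
      move=> p pPp pb; have := mass_ge0 (z0 p); rewrite le_eqVlt => /orP[/eqP <-|m0].
        by rewrite mul0r; case/andP: (ig_unit (z0 p) (f01 p)).
      have : p \in Q by rewrite mem_filter pb m0 pPp.
      by rewrite Qe.
    move=> p' _; apply: (@le_trans _ _ (mass (z' p') * 1)).
      by rewrite mulr1; case/andP: (ig_unit (z0' p') (f01 pP)).
    by apply: ler_wpM2l; [exact: mass_ge0 | rewrite lerDl].
  have [pm pmQ pmin] : exists2 pm, pm \in Q & forall p, p \in Q -> nf pm <= nf p.
    have : exists2 pm, pm \in p0 :: Q' & forall p, p \in p0 :: Q' -> nf pm <= nf p.
      elim: (Q') p0 {Qe} => [|p1 Q1 IH] p0.
        by exists p0; rewrite ?mem_head // => p; rewrite inE => /eqP ->.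
      have [pm h1 h2] := IH p1; have [le|/ltW le] := leP (nf p0) (nf pm).
        exists p0; first exact: mem_head.
        move=> p; rewrite inE => /orP[/eqP -> //|/h2]; exact: le_trans.
      exists pm; first by rewrite inE h1 orbT.
      by move=> p; rewrite inE => /orP[/eqP -> //|/h2].
    by rewrite -Qe.
  have := pmQ; rewrite mem_filter => /andP[/andP[pmb pm0] pmP].
  have /andP[i0 i1] := ig_unit (z0 pm) (f01 pm).
  exists (pm, nf pm); split=> //=.
  - by rewrite divr_ge0 ?(ltW pm0) //= ler_pdivrMr // mul1r.
  - move=> p pPp pb; have := mass_ge0 (z0 p); rewrite le_eqVlt => /orP[/eqP <-|m0].
      by rewrite mul0r; case/andP: (ig_unit (z0 p) (f01 p)).
    by rewrite mulrC -ler_pdivlMr //; apply: pmin; rewrite mem_filter pb m0 pPp.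
  - move=> p' pb'; have := mass_ge0 (z0' p'); rewrite le_eqVlt => /orP[/eqP m0|m0].
      rewrite -m0 mul0r; have /andP[_] := ig_unit (z0' p') (f01 pm).
      by rewrite -m0.
    apply: ig_le_of_cells => //; last by move=> x x'; exact: fc.
    move=> a; apply: cTP; try exact: cell_ratio01.
    have /eqP/ffunP/(_ a) := pb'; have /eqP/ffunP/(_ a) := pmb.
    by rewrite !ffunE => -> ->.
have [pm hpm] := choice opt.
exists (fun p' => (pm (dir (z' p'))).1); first by move=> p'; have [] := hpm (dir (z' p')).
rewrite -/err addrA -/err.
have low : \sum_b dirm P z b * (pm b).2 <= \sum_(p <- P) ig (z p) (f p).
  rewrite [leRHS](partition_big (fun p => dir (z p)) predT) //=.
  apply: ler_sum => b _; rewrite mulr_suml.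
  rewrite [leLHS]big_seq_cond [leRHS]big_seq_cond; apply: ler_sum => p /andP[pPp pb].
  by have [_ _ + _] := hpm b; exact.
have up : \sum_(p <- P') ig (z' p) (f (pm (dir (z' p))).1) <=
    \sum_b dirm P' z' b * ((pm b).2 + err).
  rewrite [leLHS](partition_big (fun p => dir (z' p)) predT) //=.
  apply: ler_sum => b _; rewrite mulr_suml; apply: ler_sum => p pb.
  by rewrite (eqP pb); have [_ _ _] := hpm b; exact.
apply: le_trans up _.
have errE : \sum_b dirm P' z' b * err = err.
  rewrite -mulr_suml -[RHS]mul1r; congr (_ * _).
  by rewrite -z1' [RHS](partition_big (fun p => dir (z' p)) predT).
under eq_bigr do rewrite mulrDr.
rewrite big_split /= errE addrAC lerD2r -lerBlDl.
apply: le_trans (lerB (lexx _) low) _; rewrite -sumrB mulr_natl -sumr_const.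
apply: ler_sum => b _; rewrite -mulrBl.
have [_ /andP[p0 p1] _ _] := hpm b.
apply: (@le_trans _ _ `|dirm P' z' b - dirm P z b|).
  by apply: le_trans (ler_norm _) _; rewrite normrM ler_piMr // ger0_norm.
apply: cTP'; try exact: dirm01.
by have := codeE b; rewrite !ffunE.
Qed.

End Families.
End Quantization.

(** Turns averages of different lengths into weightings of one window of length [N], the form
    required by [exists_prices]. *)
Lemma sum_prefixes (R : realType) N (t : 'I_N) n (a : nat -> R) :
  \sum_(u < N) (t.+1%:R^-1 * (n + u < n + t.+1)%N%:R) * a u =
  t.+1%:R^-1 * \sum_(u < t.+1) a u.
Proof.
rewrite (big_ord_widen N a (ltn_ord t)) mulr_sumr [RHS]big_mkcond /=.
apply: eq_bigr => u _; rewrite ltn_add2l.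
by case: ifP; rewrite ?mulr1 // mulr0 mul0r.
Qed.

(** * Stability of goodness under discretization *)

Section UniformGood.
Variables (R : realType) (K I J C D : finType).
Variable g : K -> I -> J -> R.
Hypothesis g01 : forall k i j, 0 <= g k i j <= 1.
Variable q : K -> I -> J -> dist R (K * C * D).
Variable F : dist R K -> I -> C -> dist R K.
Hypothesis qF : condA1b q F.
Variable h : C -> D.
Hypothesis qh : forall k i j, \sum_c \sum_k' q k i j (k', c, h c) = 1.
Variables (i0 : I) (j0 : J).
Variable E : finType.

Local Notation pub := (E * seq D)%type.
Local Notation strat := (pub -> dist R K -> dist R I).
Local Notation wlist := (seq (R * dist R K)).

Variable z0 : E -> wlist.
Hypothesis z0_ge0 : forall e, nng (z0 e).
Hypothesis z0_sum1 : \sum_e ig (z0 e) (fun=> 1) = 1.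


Local Notation zst := (zst q F h j0 z0).
Local Notation gam := (gam g q F h j0 z0).
Local Notation spay := (spay g q F h j0 z0).
Local Notation gs := (gs g).
Local Notation pubs := (@pubs D E).


(** If goodness failed at [(n', s')], duality would give prices that keep all continuations low
    there. Their best-reply value is 1-Lipschitz in the belief, so by [code_transport] these prices
    are nearly as effective at [(n, s)], which contradicts goodness there. The bounds do not involve
    [N]. *)
Lemma game_codes (d : R) : 0 < d -> exists (Cd : finType) (cd : nat -> strat -> Cd),
  forall n s n' s' N v, cd n s = cd n' s' ->
    good (@ag _ _ _ _ _) gam n s N v -> good (@ag _ _ _ _ _) gam n' s' N (v - d).
Proof.
move=> d_gt0.
(* Losses: [d / 8] for the prices, twice [d / 8] for the cells of beliefs, and [d / 8] for each of
   the two other discretizations, in total less than [d]. *)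
have d8 : 0 < d / 8 by rewrite divr_gt0.
have [G [c hc]] := simplex_cells K d8.
have d1_gt0 : 0 < d / 8 / (#|G|%:R + 1) by rewrite divr_gt0 // ltr_wpDl.
have [T1 [c1 hc1]] := unit_interval_cells d1_gt0.
have d2_gt0 : 0 < d / 8 / (#|{ffun G -> T1}|%:R + 1) by rewrite divr_gt0 // ltr_wpDl.
have [T2 [c2 hc2]] := unit_interval_cells d2_gt0.
have err (m : nat) : m%:R * (d / 8 / (m%:R + 1)) <= d / 8.
  rewrite mulrCA -[leRHS]mulr1 ler_wpM2l ?(ltW d8) //.
  by rewrite ler_pdivrMr ?ltr_wpDl // mul1r lerDl.
exists {ffun {ffun G -> T1} -> T2}, (fun n s => quantize c c1 c2 (pubs n) (zst s)).
move=> n s n' s' N v hcode [st sst hst]; apply: contrapT => ng.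
pose th (t : 'I_N) l : R := t.+1%:R^-1 * (l < n' + t.+1)%N%:R.
have th_ge0 t l : 0 <= th t l by rewrite mulr_ge0.
have hv s1 : ag n' s' s1 -> exists t, wsum (fun l => th t l * gam s1 l) n' N <= v - d.
  move=> ss1; apply: contrapT => nex; apply: ng; exists s1 => // -[|t] tN.
    by rewrite mul0r wsum0.
  rewrite leNgt; apply/negP => lt; apply: nex; exists (Ordinal tN).
  rewrite /wsum /th (sum_prefixes (Ordinal tN) n' (fun u => gam s1 (n' + u))) /=.
  by rewrite ler_pdivrMl // ltW.
have [bt [pi [bt0 bt1 pi0 hpi hs]]] := exists_prices g01 qh z0_ge0 z0_sum1 th_ge0 d8 hv.
pose Th l : R := \sum_t bt t * th t l.
have Th0 l : 0 <= Th l by apply: sumr_ge0 => t _; rewrite mulr_ge0.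
have Th_sum (a : nat -> R) : \sum_(u < N) Th (n' + u)%N * a u =
    \sum_t bt t * (t.+1%:R^-1 * \sum_(u < t.+1) a u).
  under [RHS]eq_bigr do rewrite -(sum_prefixes _ n') mulr_sumr.
  rewrite exchange_big /=; apply: eq_bigr => u _; rewrite /Th mulr_suml.
  by apply: eq_bigr => t _; rewrite /th !mulrA.
have Th1 : wsum Th n' N = 1.
  have := Th_sum (fun=> 1); rewrite /wsum; under eq_bigr do rewrite mulr1.
  move=> ->; rewrite -[RHS]bt1; apply: eq_bigr => t _.
  by rewrite sumr_const card_ord mulVf ?mulr1 ?pnatr_eq0.
have [s1 ss1 V1] := reply_val_attained g qF h i0 j0 z0 pi s' n' N.
have {}V1 := le_trans (eq_ind _ (fun x => x <= _) (hs _ ss1) _ (esym V1)) (lexx _).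
(* Prices have total weight one only from stage [n'] on; the value 0 at other lengths keeps [f]
   bounded and Lipschitz at every history. *)
pose f (p : pub) (x : dist R K) :=
  if size p.2 == n' then reply_val g q h i0 j0 pi N x p else 0.
have f01 p x : 0 <= f p x <= 1.
  rewrite /f; case: eqP => [pn|_]; last by rewrite lexx ler01.
  rewrite (reply_val_ge0 g01 qF) //= -Th1 -pn; apply: (reply_val_le g01 qF qh) => // p' _.
  by rewrite hpi.
have fc p x x' : c x = c x' -> f p x - f p x' <= d / 8.
  move=> /hc xx; rewrite /f; case: eqP => [pn|_]; last by rewrite subrr ltW.
  apply: le_trans xx; rewrite -[leRHS]mul1r -Th1 -pn.
  by apply: (reply_val_lipschitz g01 qh) => // p' _; rewrite hpi.
have [r rP hr] := code_transport (ltW d8) hc1 hc2 (nng_zst q F h j0 z0_ge0 s')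
  (nng_zst q F h j0 z0_ge0 s) (mass_zst F qh j0 z0_sum1 s' n')
  (mass_zst F qh j0 z0_sum1 s n) (esym hcode) f01 fc.
have low : v <= \sum_(p <- pubs n) ig (zst s p) (f (r p)).
  apply: (@le_trans _ _ (\sum_(p <- pubs n) min_val g q F h j0 Th st n' N (zst st p) p)); last first.
    rewrite [leLHS]big_seq [leRHS]big_seq; apply: ler_sum => p /size_pubs pn.
    rewrite (ag_zst _ _ _ _ _ sst) ?pn //; have := size_pubs (rP p) => rpn.
    rewrite /f rpn eqxx -{1}rpn; apply: (min_val_le_reply g qF) => //.
    exact: nng_zst.
  rewrite sum_min_val (Th_sum (fun u => gam st (n + u)%N)) -[leLHS]mul1r -[X in X * _]bt1 mulr_suml.
  apply: ler_sum => t _; rewrite ler_wpM2l // ler_pdivlMl //.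
  exact: hst.
have h1 : \sum_(p <- pubs n') ig (zst s' p) (f p) =
    \sum_(p <- pubs n') ig (zst s' p) (fun x => reply_val g q h i0 j0 pi N x p).
  rewrite [LHS]big_seq [RHS]big_seq; apply: eq_bigr => p /size_pubs pn.
  by rewrite /f pn eqxx.
have := err #|G|; have := err #|{ffun G -> T1}|; rewrite h1 in hr.
by lra.
Qed.

Lemma game_uniform_good (e : R) : 0 < e -> exists N, forall n s v N',
  good (@ag _ _ _ _ _) gam n s N v -> good (@ag _ _ _ _ _) gam n s N' (v - e).
Proof.
move=> e0; apply: uniform_good_of_codes e e0 => //; first exact: gam01.
exact: game_codes.
Qed.

End UniformGood.

(** * Payoffs in the repeated game *)

Lemma sum_tupleS (R : realType) (A : finType) n (f : n.+1.-tuple A -> R) :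
  \sum_s f s = \sum_a \sum_(s : n.-tuple A) f (cons_tuple a s).
Proof.
rewrite pair_bigA /= (reindex (fun p : A * n.-tuple A => cons_tuple p.1 p.2)) //=.
exists (fun s : n.+1.-tuple A => (thead s, [tuple of behead s])) => [[a s]|s] _ /=.
  by congr (_, _); apply: val_inj.
by rewrite [s in RHS]tuple_eta; apply: val_inj.
Qed.

Section RealPlay.
Variables (R : realType) (K I J C D : finType).
Variable g : K -> I -> J -> R.
Hypothesis g01 : forall k i j, 0 <= g k i j <= 1.
Variable q : K -> I -> J -> dist R (K * C * D).
Variables (sg : seq (I * C) -> dist R I) (ta : seq (J * D) -> dist R J).

Local Notation step := (step K I J C D).

Fixpoint play_val (th : nat -> R) (n : nat) (k : K) (h1 : seq (I * C)) (h2 : seq (J * D)) : R :=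
  if n is n'.+1 then
    \sum_i sg h1 i * \sum_j ta h2 j * (th (size h2) * g k i j +
      \sum_z q k i j z * play_val th n' z.1.1 (rcons h1 (i, z.1.2)) (rcons h2 (j, z.2)))
  else 0.

Definition nstate (k : K) n (s : n.-tuple step) (l : 'I_n) : K :=
  nth k (k :: [seq a.2.1.1 | a <- s]) l.

Definition pprob k h1 h2 n (s : n.-tuple step) : R :=
  \prod_(l < n) (sg (h1 ++ hist1 s l) (act1 s l) * ta (h2 ++ hist2 s l) (act2 s l) *
     q (nstate k s l) (act1 s l) (act2 s l) (tnth s l).2).

Definition ppay (th : nat -> R) k n (s : n.-tuple step) : R :=
  \sum_(l < n) th l * g (nstate k s l) (act1 s l) (act2 s l).

Section Cons.
Variables (n : nat) (a : step) (s : n.-tuple step) (l : 'I_n).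

Lemma act1_cons : act1 (cons_tuple a s) (lift ord0 l) = act1 s l.
Proof. by rewrite /act1 tnthS. Qed.

Lemma act2_cons : act2 (cons_tuple a s) (lift ord0 l) = act2 s l.
Proof. by rewrite /act2 tnthS. Qed.

Lemma nstate_cons k : nstate k (cons_tuple a s) (lift ord0 l) = nstate a.2.1.1 s l.
Proof.
rewrite /nstate /= /bump /= ?add1n; apply: set_nth_default.
by rewrite add0n /= size_map size_tuple ltnS ltnW.
Qed.

End Cons.

Lemma pprob_cons k h1 h2 n a (s : n.-tuple step) :
  pprob k h1 h2 (cons_tuple a s) =
  sg h1 a.1.1 * ta h2 a.1.2 * q k a.1.1 a.1.2 a.2 *
  pprob a.2.1.1 (rcons h1 (a.1.1, a.2.1.2)) (rcons h2 (a.1.2, a.2.2)) s.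
Proof.
rewrite /pprob big_ord_recl /=; congr (_ * _).
  by rewrite /hist1 /hist2 /act1 /act2 /nstate /= ?take0 !cats0 ?tnth0.
apply: eq_bigr => l _.
rewrite act1_cons act2_cons nstate_cons tnthS.
by rewrite /hist1 /hist2 /= /bump /= ?add1n /= -!cat_rcons.
Qed.

Lemma ppay_cons th k n a (s : n.-tuple step) :
  ppay th k (cons_tuple a s) =
  th 0%N * g k a.1.1 a.1.2 + ppay (fun l => th l.+1) a.2.1.1 s.
Proof.
rewrite /ppay big_ord_recl /=; congr (_ + _).
by apply: eq_bigr => l _; rewrite act1_cons act2_cons nstate_cons.
Qed.

Lemma sum_step (f : step -> R) k h1 h2 :
  \sum_a sg h1 a.1.1 * ta h2 a.1.2 * q k a.1.1 a.1.2 a.2 * f a =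
  \sum_i sg h1 i * \sum_j ta h2 j * \sum_z q k i j z * f (i, j, z).
Proof.
under [RHS]eq_bigr do rewrite mulr_sumr.
rewrite pair_bigA /=.
under [RHS]eq_bigr do rewrite !mulr_sumr.
by rewrite pair_bigA /=; apply: eq_bigr => -[[i j] z] _ /=; rewrite !mulrA.
Qed.

Lemma sum_pprob n k h1 h2 : \sum_(s : n.-tuple step) pprob k h1 h2 s = 1.
Proof.
elim: n k h1 h2 => [|n IH] k h1 h2.
  rewrite (eq_bigr (fun=> 1)) => [|s _]; last by rewrite /pprob big_ord0.
  by rewrite sumr_const card_tuple expn0.
rewrite sum_tupleS.
transitivity (\sum_a sg h1 a.1.1 * ta h2 a.1.2 * q k a.1.1 a.1.2 a.2 * (fun=> 1) a).
  by apply: eq_bigr => a _; under eq_bigr do rewrite pprob_cons; rewrite -mulr_sumr IH.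
rewrite sum_step -[RHS](dist_sum1 (sg h1)); apply: eq_bigr => i _.
rewrite -[RHS]mulr1; congr (_ * _); rewrite -[RHS](dist_sum1 (ta h2)).
apply: eq_bigr => j _; rewrite -[RHS]mulr1; congr (_ * _).
by rewrite -[RHS](dist_sum1 (q k i j)); apply: eq_bigr => z _; rewrite mulr1.
Qed.

(** Identifies the expectation over whole plays with the backward recursion, in which the current
    stage is [size h2]. *)
Lemma sum_pprob_pay th n k h1 h2 :
  \sum_(s : n.-tuple step) pprob k h1 h2 s * ppay (fun l => th (size h2 + l)%N) k s =
  play_val th n k h1 h2.
Proof.
elim: n k h1 h2 => [|n IH] k h1 h2.
  by rewrite big1 // => s _; rewrite /ppay big_ord0 mulr0.
rewrite sum_tupleS /=.
pose f (a : step) := th (size h2) * g k a.1.1 a.1.2 +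
  play_val th n a.2.1.1 (rcons h1 (a.1.1, a.2.1.2)) (rcons h2 (a.1.2, a.2.2)).
transitivity (\sum_a sg h1 a.1.1 * ta h2 a.1.2 * q k a.1.1 a.1.2 a.2 * f a).
  apply: eq_bigr => a _; under eq_bigr do rewrite pprob_cons ppay_cons addn0 -mulrA.
  rewrite -mulr_sumr; congr (_ * _); under eq_bigr do rewrite mulrDr.
  rewrite big_split /= -mulr_suml sum_pprob mul1r; congr (_ + _).
  rewrite -IH; apply: eq_bigr => s _; congr (_ * _); apply: eq_bigr => l _.
  by rewrite size_rcons addSnnS.
rewrite sum_step; apply: eq_bigr => i _; congr (_ * _); apply: eq_bigr => j _.
congr (_ * _); rewrite /f /=; under eq_bigr do rewrite mulrDr.
by rewrite big_split /= -mulr_suml dist_sum1 mul1r.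
Qed.

Lemma play_val_add th th' n k h1 h2 :
  play_val (fun l => th l + th' l) n k h1 h2 = play_val th n k h1 h2 + play_val th' n k h1 h2.
Proof.
rewrite -!sum_pprob_pay -big_split /=; apply: eq_bigr => s _.
rewrite -mulrDr /ppay -big_split /=; congr (_ * _).
by apply: eq_bigr => l _; rewrite mulrDl.
Qed.

Lemma play_val_sum (B : nat) (th : nat -> nat -> R) n k h1 h2 :
  play_val (fun l => \sum_(b < B) th b l) n k h1 h2 = \sum_(b < B) play_val (th b) n k h1 h2.
Proof.
rewrite -sum_pprob_pay; under [RHS]eq_bigr do rewrite -sum_pprob_pay.
rewrite exchange_big /=; apply: eq_bigr => s _.
rewrite -mulr_sumr /ppay exchange_big /=; congr (_ * _).
by apply: eq_bigr => l _; rewrite mulr_suml.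
Qed.

Lemma play_val_le th n k h1 h2 : (forall l, 0 <= th l) ->
  play_val th n k h1 h2 <= wsum th (size h2) n.
Proof.
move=> th0; rewrite -sum_pprob_pay -[leRHS]mul1r -(sum_pprob n k h1 h2) mulr_suml.
apply: ler_sum => s _; apply: ler_wpM2l.
  by apply: prodr_ge0 => l _; rewrite !mulr_ge0 ?dist_ge0.
apply: ler_sum => l _; rewrite ler_piMr //.
by case/andP: (g01 (nstate k s l) (act1 s l) (act2 s l)).
Qed.

End RealPlay.

Lemma gammaE_play_val (R : realType) (K I J C D : finType) (g : K -> I -> J -> R)
    (q : K -> I -> J -> dist R (K * C * D)) (mu : fdist R (K * nat * nat)) n
    (sg : strategy R I C) (ta : strategy R J D) :
  gamma g q mu n sg ta = n%:R^-1 * \sum_(w <- finsupp mu)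
    mu w * play_val g q (sg w.1.2) (ta w.2) (fun=> 1) n w.1.1 [::] [::].
Proof.
rewrite /gamma mulr_sumr; apply: eq_bigr => w _.
rewrite -sum_pprob_pay !mulr_sumr; apply: eq_bigr => s _.
have -> : \sum_(l < n) g (state w s l) (act1 s l) (act2 s l) =
    ppay g (fun=> 1) w.1.1 s by apply: eq_bigr => l _; rewrite mul1r.
rewrite -[play_prob _ _ _ _ _ _]/(mu w * pprob q (sg w.1.2) (ta w.2) w.1.1 [::] [::] s).
by rewrite mulrCA !mulrA.
Qed.

(** * From the repeated game to the process of beliefs *)

Section RealBounds.
Variables (R : realType) (K I J C D : finType).
Variable g : K -> I -> J -> R.
Variable q : K -> I -> J -> dist R (K * C * D).
Variable F : dist R K -> I -> C -> dist R K.
Hypothesis qF : condA1b q F.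
Variable h : C -> D.
Hypothesis qh : forall k i j, \sum_c \sum_k' q k i j (k', c, h c) = 1.
Hypothesis qj : condA3' q F.
Variables (i0 : I) (j0 : J).
Variable E : finType.

Local Notation pub := (E * seq D)%type.
Local Notation strat := (pub -> dist R K -> dist R I).
Local Notation wlist := (seq (R * dist R K)).

Local Notation gs := (gs g).

Section Belief.
Variables (sg : seq (I * C) -> dist R I) (ta : seq (J * D) -> dist R J).
Variable th : nat -> R.

Definition belief_val n (x : dist R K) h1 h2 : R := \sum_k x k * play_val g q sg ta th n k h1 h2.

(** By (A1b) the next state has law [F x i c] given the signals, whatever player 2 has played, so
    the recursion closes on beliefs. *)
Lemma belief_valS n (x : dist R K) h1 h2 : belief_val n.+1 x h1 h2 =
  \sum_i sg h1 i * \sum_j ta h2 j * (th (size h2) * gx g x i j +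
    \sum_c kap q h j x i c * belief_val n (F x i c) (rcons h1 (i, c)) (rcons h2 (j, h c))).
Proof.
rewrite /belief_val /=; under [LHS]eq_bigr do rewrite mulr_sumr.
rewrite exchange_big /=; apply: eq_bigr => i _.
under [LHS]eq_bigr do rewrite mulrCA.
rewrite -mulr_sumr; congr (_ * _).
under [LHS]eq_bigr do rewrite mulr_sumr.
rewrite exchange_big /=; apply: eq_bigr => j _.
under [LHS]eq_bigr do rewrite mulrCA.
rewrite -mulr_sumr; congr (_ * _).
under [LHS]eq_bigr do rewrite mulrDr mulrCA
  (sum_signals qh _ _ _ (fun z =>
    play_val g q sg ta th n z.1.1 (rcons h1 (i, z.1.2)) (rcons h2 (j, z.2)))).
rewrite big_split /= -mulr_sumr; congr (_ + _).
under [LHS]eq_bigr do rewrite mulr_sumr.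
rewrite exchange_big /=; apply: eq_bigr => c _.
under [LHS]eq_bigr do rewrite mulr_sumr.
rewrite exchange_big /= mulr_sumr; apply: eq_bigr => k' _.
rewrite mulrA -(kapF qF) /qext mulr_suml; apply: eq_bigr => k _.
by rewrite mulrA.
Qed.

End Belief.

Definition pub2 (e : E) (h2 : seq (J * D)) : pub := (e, rev [seq jd.2 | jd <- h2]).
(** Player 1 recovers the signals of player 2 from his own through [h]. *)
Definition pub1 (e : E) (h1 : seq (I * C)) : pub := (e, rev [seq h ic.2 | ic <- h1]).

Lemma pub2_rcons e h2 j d : pub2 e (rcons h2 (j, d)) = (e, d :: (pub2 e h2).2).
Proof. by rewrite /pub2 map_rcons rev_rcons. Qed.

Lemma pub1_rcons e h1 i c : pub1 e (rcons h1 (i, c)) = (e, h c :: (pub1 e h1).2).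
Proof. by rewrite /pub1 map_rcons rev_rcons. Qed.

Lemma size_pub2 e h2 : size (pub2 e h2).2 = size h2.
Proof. by rewrite size_rev size_map. Qed.

(** The weighted mixed action of player 2 depends on the public history only, and [kap_indep]
    replaces his action by [j0] in the transition; private memory then brings player 1 no more than
    a best reply. *)
Lemma belief_val_le_reply sg (ta : seq (J * D) -> dist R J) (th : nat -> R)
    (pi : pub -> J -> R) e n x h1 h2 :
  (forall h2' j, th (size h2') * ta h2' j = pi (pub2 e h2') j) ->
  belief_val sg ta th n x h1 h2 <= reply_val g q h i0 j0 pi n x (pub2 e h2).
Proof.
move=> hpi; elim: n x h1 h2 => [|n IH] x h1 h2.
  by rewrite /belief_val big1 // => k _; rewrite mulr0.
rewrite belief_valS (reply_valS g qF); apply: avg_le => i.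
apply: le_trans (maxf_ge i0 _ i); rewrite /reply_step.
have -> : \sum_j pi (pub2 e h2) j * gx g x i j =
    \sum_j ta h2 j * (th (size h2) * gx g x i j).
  by apply: eq_bigr => j _; rewrite -hpi mulrA [_ * ta _ _]mulrC.
under eq_bigr do rewrite mulrDr.
rewrite big_split /= lerD2l; apply: avg_le => j.
rewrite -(kap_indep qh qj j j0 x i (fun y d => reply_val g q h i0 j0 pi n y (e, d :: (pub2 e h2).2))).
apply: ler_sum => c _; rewrite ler_wpM2l ?kap_ge0 //.
by rewrite -(pub2_rcons _ _ j); exact: IH.
Qed.

Section Lower.
Variables (s : strat) (ta : seq (J * D) -> dist R J).

Fixpoint markov_val (n : nat) (x : dist R K) (p : pub) (h2 : seq (J * D)) : R :=
  if n is n'.+1 then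
    \sum_i s p x i * \sum_j ta h2 j * (gx g x i j +
      \sum_c kap q h j0 x i c * markov_val n' (F x i c) (p.1, h c :: p.2) (rcons h2 (j, h c)))
  else 0.

Definition bel (x : dist R K) (h1 : seq (I * C)) :=
  foldl (fun x ic => F x ic.1 ic.2) x h1.

Lemma bel_rcons x h1 i c : bel x (rcons h1 (i, c)) = F (bel x h1) i c.
Proof. by rewrite /bel -cats1 foldl_cat. Qed.

Definition play_markov (e : E) (x : dist R K) (h1 : seq (I * C)) : dist R I :=
  s (pub1 e h1) (bel x h1).

Lemma belief_val_play_markov e x n h1 h2 :
  belief_val (play_markov e x) ta (fun=> 1) n (bel x h1) h1 h2 = markov_val n (bel x h1) (pub1 e h1) h2.
Proof.
elim: n h1 h2 => [|n IH] h1 h2; first by rewrite /belief_val big1 // => k _; rewrite mulr0.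
rewrite belief_valS /=; apply: eq_bigr => i _; congr (_ * _); apply: eq_bigr => j _.
rewrite mul1r; congr (_ * (_ + _)).
rewrite -(kap_indep qh qj j j0 _ i (fun y d => markov_val n y (e, d :: (pub1 e h1).2) (rcons h2 (j, d)))).
apply: eq_bigr => c _; congr (_ * _).
by rewrite -(pub1_rcons _ _ i) -bel_rcons IH.
Qed.

(** Player 2 may condition on his own past actions [h2], but these carry no information about the
    belief, and any mixed action pays at least the stage minimum. *)
Lemma min_val_le_markov n l z p h2 : nng z ->
  min_val g q F h j0 (fun=> 1) s l n z p <= ig z (fun x => markov_val n x p h2).
Proof.
elim: n l z p h2 => [|n IH] l z p h2 z_ge0; first by rewrite ig0.
rewrite [leLHS]/= mul1r; set mi := minf _ _.
have -> : ig z (fun x => markov_val n.+1 x p h2) =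
    \sum_j ta h2 j * (ig z (gs s p j) +
      \sum_d ig (push q F h j0 s p d z) (fun x => markov_val n x (p.1, d :: p.2) (rcons h2 (j, d)))).
  have -> : ig z (fun x => markov_val n.+1 x p h2) = ig z (fun x => \sum_j ta h2 j *
      \sum_i s p x i * (gx g x i j + \sum_c kap q h j0 x i c *
         markov_val n (F x i c) (p.1, h c :: p.2) (rcons h2 (j, h c)))).
    apply: eq_ig => x /=; under eq_bigr do rewrite mulr_sumr.
    rewrite exchange_big /=; apply: eq_bigr => j _; rewrite mulr_sumr.
    by apply: eq_bigr => i _; rewrite mulrCA.
  rewrite ig_sum; apply: eq_bigr => j _; rewrite igZ; congr (_ * _).
  rewrite (sum_push q F h j0 s p z (fun d x => markov_val n x (p.1, d :: p.2) (rcons h2 (j, d)))) -igD.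
  by apply: eq_ig => x; rewrite -big_split; apply: eq_bigr => i _; rewrite mulrDr.
apply: avg_ge => j; apply: lerD; first exact: minf_le.
by apply: ler_sum => d _; apply: IH; exact: nng_push.
Qed.

End Lower.
End RealBounds.

(** * The initial information *)

Lemma measurable_singleton (R : realType) (K : finType) (p : dist R K)
    (x : borel_simplex p) : measurable [set x].
Proof.
rewrite -[X in measurable X]setCK; apply: measurableC.
apply: sub_sigma_algebra => y /= yx.
exists (\sum_k `|(y : dist R K) k - (x : dist R K) k|).
  rewrite lt_neqAle sumr_ge0 // andbT eq_sym; apply/eqP => /eqP.
  rewrite psumr_eq0 // => /allP h; apply: yx; apply: dist_eq => k.
  by have /eqP/normr0_eq0/eqP := h k (mem_index_enum _); rewrite subr_eq0 => /eqP.
by move=> z + zx; rewrite zx ltxx.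
Qed.

Section Initial.
Variables (R : realType) (K : finType) (mu : fdist R (K * nat * nat)).
Local Notation supp := (finsupp mu).
Local Notation X := (dist R K).

Lemma supp_gt0 w : w \in supp -> 0 < mu w.
Proof. by rewrite mem_finsupp lt_neqAle fdist_ge0 eq_sym => ->. Qed.

Lemma prob_supp_gt0 w (E : pred (K * nat * nat)) : w \in supp -> E w -> 0 < prob mu E.
Proof.
move=> ws Ew; rewrite /prob big_mkcond (bigD1_seq w) ?fset_uniq //= Ew.
apply: ltr_pwDl; first exact: supp_gt0.
by apply: sumr_ge0 => w' _; case: ifP => // _; exact: fdist_ge0.
Qed.

Lemma sum_supp_atom c d (f : K -> R) :
  \sum_(w <- supp | (w.1.2 == c) && (w.2 == d)) mu w * f w.1.1 =
  \sum_k mu (k, c, d) * f k.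
Proof.
transitivity (\sum_k \sum_(w <- supp | w == (k, c, d)) mu w * f k).
  rewrite (exchange_big_dep (fun w => (w.1.2 == c) && (w.2 == d))) /=; last first.
    by move=> k' w _ /eqP -> /=; rewrite !eqxx.
  apply: eq_bigr => w /andP[/eqP wc /eqP wd].
  rewrite (bigD1 w.1.1) /=; last by rewrite -wc -wd -!surjective_pairing.
  rewrite big1 ?addr0 // => k' /andP[/eqP -> /=].
  by rewrite eqxx.
apply: eq_bigr => k' _.
have [ks|ks] := boolP ((k', c, d) \in supp).
  by rewrite big_mkcond (bigD1_seq (k', c, d)) ?fset_uniq //= eqxx big1 ?addr0 // => w /negPf ->.
rewrite (fsfun_dflt ks) mul0r big_seq_cond big1 // => w /andP[ws /eqP we].
by move: ks; rewrite -we ws.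
Qed.

Hypothesis A1a : condA1a mu.

(* Given player 1's signal, the state is independent of player 2's signal. *)
Lemma sum_belief1 (f : nat -> nat -> K -> R) :
  \sum_(w <- supp) mu w * f w.1.2 w.2 w.1.1 =
  \sum_(w <- supp) mu w * \sum_k belief1 mu w.1.2 k * f w.1.2 w.2 k.
Proof.
pose cds := undup [seq (w.1.2, w.2) | w <- supp].
have group (a : K * nat * nat -> R) : \sum_(w <- supp) a w =
    \sum_(cd <- cds) \sum_(w <- supp | (w.1.2 == cd.1) && (w.2 == cd.2)) a w.
  rewrite (exchange_big_dep predT) //=; rewrite [LHS]big_seq [RHS]big_seq.
  apply: eq_bigr => w ws; rewrite big_mkcond (bigD1_seq (w.1.2, w.2)) ?undup_uniq //=; last first.
    by rewrite mem_undup (map_f (fun w => (w.1.2, w.2))).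
  rewrite !eqxx big1 ?addr0 // => -[c d] /=; case: ifP => // /andP[/eqP <- /eqP <-].
  by rewrite eqxx.
rewrite !group [LHS]big_seq [RHS]big_seq; apply: eq_bigr => -[c d] /=.
rewrite mem_undup => /mapP[w0 w0s [ec ed]].
have c0 : 0 < prob mu (fun w => w.1.2 == c).
  by apply: (prob_supp_gt0 w0s); rewrite ec.
transitivity (\sum_k mu (k, c, d) * f c d k).
  rewrite -sum_supp_atom; apply: eq_bigr => w /andP[/eqP -> /eqP ->].
  by [].
transitivity (prob mu (fun w => (w.1.2 == c) && (w.2 == d)) *
    \sum_k belief1 mu c k * f c d k); last first.
  rewrite /prob mulr_suml; apply: eq_bigr => w /andP[/eqP -> /eqP ->].
  by [].
rewrite mulr_sumr; apply: eq_bigr => k _; rewrite mulrA; congr (_ * _).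
rewrite (belief1E _ c0) mulrA; apply: (canRL (mulfK (lt0r_neq0 c0))).
by rewrite mulrC A1a mulrC.
Qed.

Definition wlist1 (P : pred (K * nat * nat)) : seq (R * X) :=
  [seq (mu w, belief1 mu w.1.2) | w <- [seq w <- supp | P w]].

Lemma ig_wlist1 P f : ig (wlist1 P) f = \sum_(w <- supp | P w) mu w * f (belief1 mu w.1.2).
Proof. by rewrite /ig /wlist1 big_map big_filter. Qed.

Lemma nng_wlist1 P : nng (wlist1 P).
Proof. by apply/allP => a /mapP[w _ ->]; exact: fdist_ge0. Qed.

(* Normalized belief of player 2 about player 1's belief. *)
Definition y1 (d : nat) (f : X -> R) : R :=
  ig (wlist1 (fun w => w.2 == d)) f / prob mu (fun w => w.2 == d).

(** Both laws are finitely supported, so testing them on singletons, which are Borel, is enough. *)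
Lemma y1_of_belief2 d d' :
  (forall A : set (borel_simplex (state_law mu)), measurable A ->
     belief2 mu d A = belief2 mu d' A) ->
  forall f, y1 d f = y1 d' f.
Proof.
move=> hA f.
pose u := undup [seq belief1 mu w.1.2 | w <- supp].
have y1E d0 : y1 d0 f = \sum_(x <- u) prob mu (fun w => (w.2 == d0) && (belief1 mu w.1.2 == x))
    / prob mu (fun w => w.2 == d0) * f x.
  rewrite /y1 (ig_atoms f (undup_uniq [seq belief1 mu w.1.2 | w <- supp])); last first.
    move=> x /mapP[a /mapP[w + ->] ->] /=; rewrite mem_filter => /andP[_ ws].
    by rewrite mem_undup (map_f (fun w => belief1 mu w.1.2)).
  rewrite mulr_suml; apply: eq_bigr => x _; rewrite mulrAC; congr (_ / _ * _).
  rewrite ig_wlist1 /prob [RHS]big_mkcondr; apply: eq_bigr => w _.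
  by case: eqP; rewrite ?mulr1 ?mulr0.
rewrite !y1E; apply: eq_bigr => x _; congr (_ * _).
have in1 y : (y \in [set x]%classic) = (y == x).
  by apply/idP/eqP => [/set_mem|->]; last exact: mem_set.
have := hA _ (measurable_singleton (x : borel_simplex (state_law mu))).
rewrite /belief2 => -[]; rewrite /prob.
under eq_bigl do rewrite in1; move=> ->.
by under eq_bigl do rewrite in1.
Qed.

Definition signals2 := undup [seq w.2 | w <- supp].

Lemma mem_signals2 w : w \in supp -> w.2 \in signals2.
Proof. by move=> ws; rewrite mem_undup (map_f snd). Qed.

(* Two signals of player 2 are identified when they induce the same [y1]. *)
Definition cls (d : nat) : 'I_(size signals2).+1 :=
  inord (find (fun d' => `[< forall f, y1 d' f = y1 d f >]) signals2).

Lemma cls_y1 d d' : d \in signals2 -> d' \in signals2 -> cls d = cls d' ->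
  forall f, y1 d f = y1 d' f.
Proof.
move=> ds ds' /(congr1 (@nat_of_ord _)); rewrite !inordK ?ltnS ?find_size // => e f.
have has_y d0 : d0 \in signals2 -> has (fun d' => `[< forall f, y1 d' f = y1 d0 f >]) signals2.
  by move=> h; apply/hasP; exists d0 => //; apply/asboolP.
have /asboolP h1 := nth_find 0%N (has_y _ ds).
have /asboolP h2 := nth_find 0%N (has_y _ ds').
by rewrite -h1 -h2 e.
Qed.

Lemma y1_cls d d' : (forall f, y1 d f = y1 d' f) -> cls d = cls d'.
Proof.
move=> h; rewrite /cls; congr inord; apply: eq_find => d0 /=.
by apply: asbool_equiv_eq; split=> h' f; rewrite h' h.
Qed.

Definition init_state e := wlist1 (fun w => cls w.2 == e).

Lemma sum_init (f : 'I_(size signals2).+1 -> X -> R) :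
  \sum_e ig (init_state e) (f e) =
  \sum_(w <- supp) mu w * f (cls w.2) (belief1 mu w.1.2).
Proof.
under eq_bigr do rewrite ig_wlist1.
rewrite (exchange_big_dep predT) //=; apply: eq_bigr => w _.
by rewrite (big_pred1 (cls w.2)) // => e; rewrite eq_sym.
Qed.

Lemma nng_init e : nng (init_state e).
Proof. exact: nng_wlist1. Qed.

Lemma sum_init1 : \sum_e ig (init_state e) (fun=> 1) = 1.
Proof.
rewrite (sum_init (fun _ _ => 1)) -[RHS](fdist_sum1 mu).
by apply: eq_bigr => w _; rewrite mulr1.
Qed.

Lemma sum_signals2 (P : pred nat) (a : K * nat * nat -> R) :
  \sum_(w <- supp | P w.2) a w = \sum_(d <- signals2 | P d) \sum_(w <- supp | w.2 == d) a w.
Proof.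
rewrite (exchange_big_dep (fun w => P w.2)) /=; last by move=> d w Pd /eqP ->.
rewrite [LHS]big_seq_cond [RHS]big_seq_cond; apply: eq_bigr => w /andP[ws Pw].
rewrite big_mkcond (bigD1_seq w.2) ?mem_signals2 ?undup_uniq //= Pw eqxx.
by rewrite big1 ?addr0 // => d /negPf h; rewrite eq_sym h andbF.
Qed.

(* The conditional law of player 1's belief given player 2's signal [d] only
   depends on the class of [d], so splitting a class brings nothing to player 2. *)
Lemma sum_init_le (m : 'I_(size signals2).+1 -> R)
    (f : nat -> 'I_(size signals2).+1 -> X -> R) :
  (forall d e, m e <= ig (init_state e) (f d e)) ->
  \sum_e m e <= \sum_(w <- supp) mu w * f w.2 (cls w.2) (belief1 mu w.1.2).
Proof.
move=> hm; pose pe e := prob mu (fun w => cls w.2 == e).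
pose pd d := prob mu (fun w => w.2 == d).
have peE e : pe e = \sum_(d <- signals2 | cls d == e) pd d.
  by rewrite /pe /prob (sum_signals2 (fun d => cls d == e)).
have pd_gt0 d : d \in signals2 -> 0 < pd d.
  by rewrite mem_undup => /mapP[w ws ->]; apply: (prob_supp_gt0 ws) => /=.
have igE d f' : d \in signals2 -> ig (wlist1 (fun w => w.2 == d)) f' = pd d * y1 d f'.
  by move=> ds; rewrite /y1 mulrC divfK // gt_eqF ?pd_gt0.
have initE d f' : d \in signals2 -> ig (init_state (cls d)) f' = pe (cls d) * y1 d f'.
  move=> ds; rewrite peE mulr_suml ig_wlist1 (sum_signals2 (fun d' => cls d' == cls d)).
  rewrite [LHS]big_seq_cond [RHS]big_seq_cond; apply: eq_bigr => d' /andP[ds' /eqP dd'].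
  by rewrite -ig_wlist1 igE // (cls_y1 ds' ds dd').
have -> : \sum_(w <- supp) mu w * f w.2 (cls w.2) (belief1 mu w.1.2) =
    \sum_(d <- signals2) pd d * y1 d (f d (cls d)).
  rewrite (sum_signals2 predT) [LHS]big_seq [RHS]big_seq; apply: eq_bigr => d ds.
  by rewrite -igE // ig_wlist1; apply: eq_bigr => w /eqP ->.
apply: (@le_trans _ _ (\sum_(d <- signals2) pd d * (m (cls d) / pe (cls d)))); last first.
  rewrite [leLHS]big_seq [leRHS]big_seq; apply: ler_sum => d ds.
  apply: ler_wpM2l; first exact: ltW (pd_gt0 _ ds).
  have pe0 : 0 < pe (cls d).
    by move: ds; rewrite mem_undup => /mapP[w ws ->]; apply: (prob_supp_gt0 ws) => /=.
  by rewrite ler_pdivrMr // mulrC -initE.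
rewrite [leRHS](partition_big cls predT) //=; apply: ler_sum => e _.
(* In a class of probability zero the quotient is meaningless, but [m e] is bounded by an empty
   integral and no signal in [signals2] belongs to the class. *)
have [pe0|pe0] := eqVneq (pe e) 0; last first.
  rewrite (eq_bigr (fun d => pd d * (m e / pe e))) => [|d /eqP -> //].
  by rewrite -mulr_suml -peE mulrC divfK.
apply: le_trans (hm 0%N e) _; rewrite ig_wlist1 big_seq_cond big1; last first.
  move=> w /andP[ws we]; have := prob_supp_gt0 (E := fun w => cls w.2 == e) ws we.
  by rewrite -/(pe e) pe0 ltxx.
rewrite big_seq_cond big1 // => d /andP[ds de].
have : 0 < pe e.
  rewrite peE big_mkcond (bigD1_seq d) ?undup_uniq //= de ltr_pwDl ?pd_gt0 //.
  by apply: sumr_ge0 => d' _; case: ifP => // _; apply: sumr_ge0 => w _; exact: fdist_ge0.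
by rewrite pe0 ltxx.
Qed.

Hypothesis A2a : condA2a mu.

(** By (A2a), draws of positive probability with the same signal of player 1 induce the same law of
    beliefs for player 2, hence the same class. *)
Lemma exists_class1 : exists e1 : nat -> 'I_(size signals2).+1,
  forall w, w \in supp -> e1 w.1.2 = cls w.2.
Proof.
have [f1 hf1] := A2a.
have ex c : exists e, forall w, w \in supp -> w.1.2 = c -> e = cls w.2.
  have [[w [ws wc]]|nw] := pselect (exists w, w \in supp /\ w.1.2 = c); last first.
    by exists ord0 => w ws wc; case: nw; exists w.
  exists (cls w.2) => w' ws' wc'; apply: y1_cls; apply: y1_of_belief2 => A mA.
  by rewrite (hf1 _ (supp_gt0 ws)) // (hf1 _ (supp_gt0 ws')) // wc wc'.
by have [e1 he1] := choice ex; exists e1 => w ws; exact: he1.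
Qed.

End Initial.

Arguments cls {R K} mu d.
Arguments init_state {R K} mu e.

(** * Guarantees of the two players *)

Section Guarantees.
Variables (R : realType) (K I J C D : finType).
Variable g : K -> I -> J -> R.
Hypothesis g01 : forall k i j, 0 <= g k i j <= 1.
Variable q : K -> I -> J -> dist R (K * C * D).
Variable F : dist R K -> I -> C -> dist R K.
Hypothesis qF : condA1b q F.
Variable h : C -> D.
Hypothesis qh : forall k i j, \sum_c \sum_k' q k i j (k', c, h c) = 1.
Hypothesis qj : condA3' q F.
Variable mu : fdist R (K * nat * nat).
Hypotheses (A1a : condA1a mu) (A2a : condA2a mu).
Variables (i0 : I) (j0 : J).

Local Notation supp := (finsupp mu).
Local Notation z0 := (init_state mu).
Local Notation E := 'I_(size (signals2 mu)).+1.
Local Notation gam := (gam g q F h j0 z0).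

Definition windows : set R :=
  [set v | forall T, exists m s, T%:R * v <= wsum (gam s) m T]%classic.

Definition game_value : R := sup windows.

Let z0_ge0 := @nng_init R K mu.
Let z0_sum1 := sum_init1 mu.
Let gam_01 := gam01 g01 F qh j0 z0_ge0 z0_sum1.

Lemma has_sup_windows : has_sup windows.
Proof.
split; first exists 0.
  move=> T; exists 0%N, (fun _ _ => dirac_dist R i0); rewrite mulr0.
  exact: wsum_ge0.
exists 1 => v /(_ 1%N) [m [s]]; rewrite mul1r => /le_trans; apply.
exact: wsum_le.
Qed.

Lemma game_value_ge0 : 0 <= game_value.
Proof.
apply: sup_upper_bound; first exact: has_sup_windows.
move=> T; exists 0%N, (fun _ _ => dirac_dist R i0); rewrite mulr0.
exact: wsum_ge0.
Qed.

Lemma gammaE n sg ta : gamma g q mu n sg ta = n%:R^-1 * \sum_(w <- supp) mu w *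
  belief_val g q (sg w.1.2) (ta w.2) (fun=> 1) n (belief1 mu w.1.2) [::] [::].
Proof.
rewrite gammaE_play_val; congr (_ * _).
exact: (sum_belief1 A1a (fun c d k => play_val g q (sg c) (ta d) (fun=> 1) n k [::] [::])).
Qed.

(** Player 1 runs the strategy of the dynamic program on the class and belief that he computes from
    his signal; [sum_init_le] handles the fact that player 2 sees his signal and not merely its
    class. *)
Lemma guarantee1_value : guarantee1 g q mu game_value.
Proof.
move=> e e0; have e2 : 0 < e / 2 by rewrite divr_gt0.
have [v hv ve] := sup_adherent e2 has_sup_windows.
have agr n (s : E * seq D -> dist R K -> dist R I) : ag n s s by [].
have agl m n (s1 s2 : E * seq D -> dist R K -> dist R I) :
    (m <= n)%N -> ag n s1 s2 -> ag m s1 s2.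
  by move=> mn h12 p pm; apply: h12; apply: leq_trans mn.
have [s [N hs]] := long_run_of_windows agr agl (@ag_gam _ _ _ _ _ _ g q F h j0 _ z0)
  (@ag_lim _ _ _ _ _) gam_01
  (@game_uniform_good _ _ _ _ _ _ _ g01 _ _ qF _ qh i0 j0 _ _ z0_ge0 z0_sum1) e2 hv.
have [e1 he1] := exists_class1 A2a.
exists (fun c => play_markov F h s (e1 c) (belief1 mu c)), N.+1 => n ta Nn.
have n0 : 0 < n%:R :> R by rewrite ltr0n; apply: leq_trans Nn.
rewrite gammaE ler_pdivlMl //.
have low : \sum_e min_val g q F h j0 (fun=> 1) s 0 n (z0 e) (e, [::]) <=
    \sum_(w <- supp) mu w *
      markov_val g q F h j0 s (ta w.2) n (belief1 mu w.1.2) (cls mu w.2, [::]) [::].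
  apply: (sum_init_le (m := fun e => min_val g q F h j0 (fun=> 1) s 0 n (z0 e) (e, [::]))
    (f := fun d e x => markov_val g q F h j0 s (ta d) n x (e, [::]) [::])) => d e'.
  exact: min_val_le_markov.
have sumM := sum_min_val g q F h j0 z0 (fun=> 1) s 0 n 0.
rewrite sum_pubs0 in sumM.
apply: (@le_trans _ _ (\sum_e min_val g q F h j0 (fun=> 1) s 0 n (z0 e) (e, [::]))).
  rewrite sumM; have := hs n (ltnW Nn); rewrite /wsum.
  under [in X in _ -> X]eq_bigr do rewrite mul1r.
  apply: le_trans; rewrite ler_wpM2l ?(ltW n0) //.
  by move: ve; rewrite -/game_value; lra.
apply: le_trans low _; rewrite big_seq [leRHS]big_seq; apply: ler_sum => w ws.
rewrite ler_wpM2l ?fdist_ge0 // -(he1 _ ws).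
by rewrite -(belief_val_play_markov g qF qh qj j0 s (ta w.2) (e1 w.1.2) (belief1 mu w.1.2) n [::] [::]).
Qed.

Definition block (T b l : nat) : R := (b * T <= l < b.+1 * T)%N%:R.

Lemma sum_block T B l : (0 < T)%N ->
  \sum_(b < B) block T b l + (B * T <= l)%N%:R = 1.
Proof.
move=> T0; elim: B => [|B IH]; first by rewrite big_ord0 add0r mul0n.
rewrite big_ord_recr /= -[RHS]IH -addrA; congr (_ + _).
rewrite /block; case: (leqP (B * T) l) => h1; case: (leqP (B.+1 * T) l) => h2 /=.
- by rewrite add0r.
- by rewrite addr0.
- by exfalso; move: h1; rewrite ltnNge (leq_trans _ h2) // leq_mul2r leqnSn orbT.
- by rewrite addr0.
Qed.

(** The prices for block [b] are found in the game started at stage 0 with weights vanishing outside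
    the block, so they are good whatever player 1 does before it. The incomplete last block costs at
    most [T]. *)
Lemma guarantee2_of_blocks T (v e : R) : (0 < T)%N -> 0 <= v -> 0 < e ->
  (forall m s, wsum (gam s) m T <= T%:R * v) ->
  exists (ta : strategy R J D) (N : nat),
    forall n sg, (N <= n)%N -> gamma g q mu n sg ta <= v + e.
Proof.
move=> T0 v0 e0 hT.
have TR0 : 0 < T%:R :> R by rewrite ltr0n.
have price b : exists pi : E * seq D -> J -> R, [/\ forall p j, 0 <= pi p j,
    forall p, \sum_j pi p j = block T b (size p.2) &
    \sum_e ig (z0 e) (fun x => reply_val g q h i0 j0 pi (b.+1 * T) x (e, [::]))
      <= T%:R * v + T%:R * (e / 2)].
  pose s0 : E * seq D -> dist R K -> dist R I := fun _ _ => dirac_dist R i0.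
  have Te : 0 < T%:R * (e / 2) by rewrite mulr_gt0 // divr_gt0.
  have th0 (t : unit) l : 0 <= block T b l by rewrite /block.
  have hv s : ag 0 s0 s -> exists t : unit,
      wsum (fun l => block T b l * gam s l) 0 (b.+1 * T) <= T%:R * v.
    move=> _; exists tt; apply: le_trans (hT (b * T)%N s).
    rewrite mulSnr wsumD /wsum add0n [X in X + _]big1 ?add0r => [|l _].
      apply: ler_sum => l _; rewrite ler_piMl //; first by case/andP: (gam_01 s (b * T + l)).
      by rewrite /block; case: (_ && _); rewrite ?ler01.
    by rewrite /block add0n leqNgt ltn_ord mul0r.
  have [bt [pi [bt0 bt1 pi0 hpi hs]]] := exists_prices g01 qh z0_ge0 z0_sum1 th0 Te hv.
  have [s ss hV] := reply_val_attained g qF h i0 j0 z0 pi s0 0 (b.+1 * T).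
  exists pi; split=> //.
    by move=> p; rewrite hpi (big_pred1 tt) // -[RHS]mul1r -bt1 (big_pred1 tt) //; case.
  by rewrite sum_pubs0 in hV; rewrite hV; exact: hs.
have [pi hpi] := choice price.
(* Inside its block, a price vector has total one and is thus a mixed action. *)
pose ta0 (p : E * seq D) : dist R J :=
  mkdist (dirac_dist R j0) (pi (size p.2 %/ T)%N p).
pose ta (d : nat) (h2 : seq (J * D)) := ta0 (pub2 (cls mu d) h2).
have blockE b p j : block T b (size p.2) * ta0 p j = pi b p j.
  have [pi0 pi1 _] := hpi b; have := pi1 p.
  rewrite /block; case: (boolP (b * T <= size p.2 < b.+1 * T)%N) => [inb|_] pi1p; last first.
    rewrite mul0r; have /eqP := pi1p; rewrite psumr_eq0 // => /allP hz.
    by apply/esym/eqP; exact: (hz j (mem_index_enum j)).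
  rewrite mul1r /ta0; have -> : (size p.2 %/ T)%N = b.
    apply/eqP; rewrite eqn_leq; case/andP: inb => b1 b2.
    by rewrite leq_divRL // b1 andbT -ltnS ltn_divLR.
  by rewrite mkdistE.
(* Half of [e] pays for the incomplete block, the other half for the approximate prices. *)
have [N hN] := ex_nat_ge (T%:R / (e / 2)).
exists ta, N.+1 => n sg Nn.
have n0 : 0 < n%:R :> R by rewrite ltr0n; apply: leq_trans Nn.
rewrite gammaE ler_pdivrMl //.
pose B := (n %/ T)%N.
pose rest l : R := (B * T <= l)%N%:R.
have one : (fun=> 1) = (fun l : nat => \sum_(b < B) block T b l + rest l).
  by apply: funext => l; rewrite sum_block.
pose pay (th : nat -> R) (w : K * nat * nat) :=
  belief_val g q (sg w.1.2) (ta w.2) th n (belief1 mu w.1.2) [::] [::].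
have split_pay : \sum_(w <- supp) mu w * pay (fun=> 1) w =
    \sum_(b < B) \sum_(w <- supp) mu w * pay (block T b) w +
    \sum_(w <- supp) mu w * pay rest w.
  rewrite exchange_big -big_split; apply: eq_bigr => w _ /=.
  rewrite -mulr_sumr -mulrDr; congr (_ * _); rewrite /pay /belief_val exchange_big -big_split.
  apply: eq_bigr => k _ /=; rewrite -mulr_sumr -mulrDr; congr (_ * _).
  by rewrite one play_val_add play_val_sum.
rewrite -[leLHS]/(\sum_(w <- supp) mu w * pay (fun=> 1) w) split_pay.
have in_block (b : 'I_B) : \sum_(w <- supp) mu w * pay (block T b) w <=
    T%:R * v + T%:R * (e / 2).
  have [pi0 pi1 hV] := hpi b; apply: le_trans hV.
  rewrite (sum_init (fun e x => reply_val g q h i0 j0 (pi b) (b.+1 * T) x (e, [::]))).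
  apply: ler_sum => w _; rewrite ler_wpM2l ?fdist_ge0 //.
  have bn : (b.+1 * T + (n - b.+1 * T) = n)%N.
    rewrite subnKC // -leq_divRL //; exact: ltn_ord.
  rewrite -(reply_val_pad g qF h i0 j0 (pi := pi b) (n - b.+1 * T)) => [|p' /= sp j]; last first.
    apply/eqP; have /eqP := pi1 p'; rewrite /block [(size p'.2 < _)%N]ltnNge.
    rewrite add0n in sp; rewrite sp andbF psumr_eq0 // => /allP; apply.
    exact: mem_index_enum.
  rewrite bn; apply: (@belief_val_le_reply _ _ _ _ _ _ g _ _ qF _ qh qj i0 j0 _ _ _ _ _ (cls mu w.2)) => h2' j.
  by rewrite -blockE size_pub2.
have in_rest : \sum_(w <- supp) mu w * pay rest w <= T%:R.
  rewrite -[leRHS]mul1r -[X in X * _](fdist_sum1 mu) mulr_suml; apply: ler_sum => w _.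
  rewrite ler_wpM2l ?fdist_ge0 //; apply: avg_le => k.
  apply: (@le_trans _ _ (wsum rest 0 n)); first by apply: (play_val_le g01) => l; rewrite /rest.
  rewrite (divn_eq n T) wsumD [X in X + _]big1 ?add0r => [|l _]; last first.
    by rewrite /rest add0n leqNgt ltn_ord.
  apply: (@le_trans _ _ (n %% T)%N%:R).
    by apply: wsum_le => l; rewrite /rest; case: leq; rewrite ?lexx ?ler01.
  by rewrite ler_nat ltnW // ltn_mod.
apply: le_trans (lerD (ler_sum _ (fun b _ => in_block b)) in_rest) _.
rewrite sumr_const card_ord -[X in X + _]mulr_natl -mulrDr mulrA.
have hBT : B%:R * T%:R <= n%:R :> R by rewrite -natrM ler_nat leq_trunc_div.
have hTn : T%:R <= n%:R * (e / 2).
  rewrite -ler_pdivrMr ?divr_gt0 //; apply: le_trans hN _.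
  by rewrite ler_nat; exact: ltnW.
have ve0 : 0 <= v + e / 2 by rewrite addr_ge0 // ltW // divr_gt0.
have := ler_wpM2r ve0 hBT.
by rewrite [n%:R * (v + e)]mulrDr; rewrite [n%:R * (v + e / 2)]mulrDr; lra.
Qed.

Lemma guarantee2_value : guarantee2 g q mu game_value.
Proof.
move=> e e0; pose v := game_value + e / 2.
have nv : ~ windows v.
  move=> /(sup_upper_bound has_sup_windows); rewrite -/game_value /v.
  by lra.
have [T hT] : exists T, forall m s, wsum (gam s) m T < T%:R * v.
  apply: contrapT => nT; apply: nv => T; apply: contrapT => nm; apply: nT.
  exists T => m s; rewrite ltNge; apply/negP => le; apply: nm.
  by exists m, s.
have T0 : (0 < T)%N.
  case: T hT => // /(_ 0%N (fun _ _ => dirac_dist R i0)).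
  by rewrite wsum0 mul0r ltxx.
have -> : game_value + e = v + e / 2 by rewrite /v; lra.
apply: guarantee2_of_blocks T0 _ _ _.
- by rewrite /v addr_ge0 ?game_value_ge0 // ltW // divr_gt0.
- by rewrite divr_gt0.
- by move=> m s; exact: ltW.
Qed.

End Guarantees.

(** * Existence of the value, and empty action sets *)

Section UniformValue.
Variables (R : realType) (K I J C D : finType).
Variables (g : K -> I -> J -> R) (q : K -> I -> J -> dist R (K * C * D)).
Variable mu : fdist R (K * nat * nat).

Lemma guarantee_le v w : guarantee1 g q mu v -> guarantee2 g q mu w -> v <= w.
Proof.
move=> hv hw; apply/ler_addgt0Pr => e e0; have e2 : 0 < e / 2 by rewrite divr_gt0.
have [sg [N hN]] := hv _ e2; have [ta [N' hN']] := hw _ e2.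
have h1 := hN (maxn N N') ta (leq_maxl _ _).
have h2 := hN' (maxn N N') sg (leq_maxr _ _).
by lra.
Qed.

Lemma has_uniform_value_of_guarantees v :
  guarantee1 g q mu v -> guarantee2 g q mu v -> has_uniform_value g q mu.
Proof.
move=> h1 h2; transitivity v; apply/eqP; rewrite eq_le; apply/andP; split.
- by apply: ge_sup; [exists v | move=> w hw; exact: guarantee_le h2].
- by apply: ub_le_sup => //; exists v => w hw; exact: guarantee_le h2.
- by apply: lb_le_inf; [exists v | move=> w hw; exact: guarantee_le hw].
- by apply: ge_inf => //; exists v => w hw; exact: guarantee_le hw.
Qed.

Lemma no_dist (T : finType) : (T -> False) -> dist R T -> False.
Proof.
move=> nT p; have := dist_sum1 p; rewrite big1 => [/eqP|t]; last by case: (nT t).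
by rewrite eq_sym oner_eq0.
Qed.

(* With no action for one of the players, one of the two sets of guaranteed
   values is empty and the other one is empty or everything: [sup] and [inf] are
   then both [0] by convention. *)
Lemma has_uniform_value_no_action1 : (I -> False) -> has_uniform_value g q mu.
Proof.
move=> nI; have nS (sg : strategy R I C) : False := no_dist nI (sg 0%N [::]).
transitivity (0 : R); [apply: sup_out | apply/esym/inf_out].
  by move=> [[v /(_ 1 ltr01) [sg _]] _].
move=> [[v /(_ 1 ltr01) [ta _]] [b hb]].
have : b <= b - 1 by apply: hb => e e0; exists ta, 0%N => n sg; case: (nS sg).
by rewrite lerBrDl gerDr ler10.
Qed.

Lemma has_uniform_value_no_action2 : (J -> False) -> has_uniform_value g q mu.
Proof.
move=> nJ; have nT (ta : strategy R J D) : False := no_dist nJ (ta 0%N [::]).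
transitivity (0 : R); [apply: sup_out | apply/esym/inf_out].
  move=> [[v /(_ 1 ltr01) [sg _]] [b hb]].
  have : b + 1 <= b by apply: hb => e e0; exists sg, 0%N => n ta; case: (nT ta).
  by rewrite gerDl ler10.
by move=> [[v /(_ 1 ltr01) [ta _]] _].
Qed.

End UniformValue.

Theorem corollary4p11 (R : realType) (K I J C D : finType)
    (g : K -> I -> J -> R) (hg : forall k i j, 0 <= g k i j <= 1)
    (q : K -> I -> J -> dist R (K * C * D))
    (F : dist R K -> I -> C -> dist R K)
    (hA1b : condA1b q F) (hA2b : condA2b' q) (hA3 : condA3' q F)
    (mu : fdist R (K * nat * nat)) (hA1a : condA1a mu) (hA2a : condA2a mu) :
  has_uniform_value g q mu.
Proof.
have [h qh] := hA2b.
have [i0 _|nI] := pickP (fun _ : I => true); last first.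
  by apply: has_uniform_value_no_action1 => i; have := nI i.
have [j0 _|nJ] := pickP (fun _ : J => true); last first.
  by apply: has_uniform_value_no_action2 => j; have := nJ j.
apply: has_uniform_value_of_guarantees.
  exact: (guarantee1_value hg hA1b qh hA3 hA1a hA2a i0 j0).
exact: (guarantee2_value hg hA1b qh hA3 hA1a i0 j0).
Qed.
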